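(* Let $L$ be a semiprime Lie algebra over a field $k$ of characteristic zero satisfying the standard Lie identity of degree $5$. Then $L$ satisfies all identities satisfied by the Lie algebra $\widetilde{W}_1=\mathrm{Diff}\, k[[x]]$. That is, for every element $f(x_1,\ldots,x_n)$ of a free Lie algebra over $k$ such that $f$ vanishes under all substitutions of elements of $\widetilde{W}_1$ for $x_1,\ldots,x_n$, one has $f(l_1,\ldots,l_n)=0$ for all $l_1,\ldots,l_n\in L$.
   Context: For a commutative $k$-algebra $A$ with a $k$-linear derivation $a\mapsto a'$, the Lie algebra of special derivations of $A$ is $\mathrm{Diff}\, A=\{a\partial \mid a\in A\}$ with bracket $[a\partial,b\partial]=(ab'-a'b)\partial$. The algebra of formal power series $k[[x]]$ is considered with the derivation $\frac{\partial}{\partial x}$. A Lie algebra $L$ is semiprime if $[I,I]\neq 0$ for any nonzero ideal $I\subset L$. A Lie algebra $L$ satisfies the standard Lie identity of degree $5$ ($\mathrm{St}_5$) if $$\sum_{\sigma\in S_4}(-1)^{\sigma}\,\mathrm{ad}\,x_{\sigma(1)}\,\mathrm{ad}\,x_{\sigma(2)}\,\mathrm{ad}\,x_{\sigma(3)}\,\mathrm{ad}\,x_{\sigma(4)}\,z=0$$ for all $x_1,x_2,x_3,x_4,z\in L$, where $(-1)^\sigma$ is the sign of $\sigma$. *)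

(* Defs.v *)
From HB Require Import structures.
From mathcomp Require Import all_boot all_order perm all_algebra.
From mathcomp Require Import boolp classical_sets functions.
From mathcomp Require Import ring.
Set Implicit Arguments.
Unset Strict Implicit.
Unset Printing Implicit Defensive.
Import GRing.Theory.
Local Open Scope ring_scope.
Local Open Scope quotient_scope.

HB.mixin Record Lmodule_isLie (k : fieldType) L of GRing.Lmodule k L := {
  lbr : L -> L -> L;
  lbr_linearl : forall y, linear (lbr^~ y);
  lbr_linearr : forall x, linear (lbr x);
  lbrxx : forall x, lbr x x = 0;
  lbr_jacobi : forall x y z,
    lbr x (lbr y z) + lbr y (lbr z x) + lbr z (lbr x y) = 0
}.

#[short(type="lieAlgType")]
HB.structure Definition LieAlgebra (k : fieldType) :=
  {L of GRing.Lmodule k L & Lmodule_isLie k L}.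

Section LieNotions.
Variables (k : fieldType) (L : lieAlgType k).

Definition ad (x : L) : L -> L := fun y => lbr x y.

Definition is_subspace (V : set L) : Prop :=
  V 0 /\ forall (a : k) (u v : L), V u -> V v -> V (a *: u + v).

Definition is_lie_ideal (I : set L) : Prop :=
  is_subspace I /\ forall x y : L, I y -> I (lbr x y).

Definition lie_prod (I J : set L) : set L :=
  smallest is_subspace [set z | exists x y, [/\ I x, J y & z = lbr x y]].

Definition lie_semiprime : Prop :=
  forall I : set L, is_lie_ideal I ->
    I <> [set 0]%classic -> lie_prod I I <> [set 0]%classic.

(* The four x's are indexed by 'I_4; (-1) ^+ s is the sign of s, through the
   parity coercion of permutations to bool. *)
Definition standard_lie_identity5 : Prop :=
  forall (x : 'I_4 -> L) (z : L),
    \sum_(s : 'S_4) (-1) ^+ s *: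
      ad (x (s (inord 0))) (ad (x (s (inord 1)))
        (ad (x (s (inord 2))) (ad (x (s (inord 3))) z))) = 0.

End LieNotions.

HB.mixin Record ComAlgebra_hasDerivation (k : fieldType) A
    of GRing.ComAlgebra k A := {
  der : A -> A;
  der_linear : linear der;
  derM : forall a b : A, der (a * b) = der a * b + a * der b
}.

#[short(type="diffAlgType")]
HB.structure Definition DiffAlgebra (k : fieldType) :=
  {A of GRing.ComAlgebra k A & ComAlgebra_hasDerivation k A}.

(* The element a : Diff A stands for the special derivation a d, where d is
   the derivation of A. *)
Definition Diff (k : fieldType) (A : diffAlgType k) : Type := A.

Section Diff.
Variables (k : fieldType) (A : diffAlgType k).

HB.instance Definition _ := GRing.Lmodule.copy (Diff A) A.

Definition Diff_lbr (a b : Diff A) : Diff A :=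
  (a : A) * der (b : A) - der (a : A) * (b : A).

Fact Diff_lbr_linearr a : linear (Diff_lbr a).
Proof.
move=> c u v; rewrite /Diff_lbr der_linear !mulrDr -!scalerAr scalerBr.
by rewrite opprD addrACA.
Qed.

Fact Diff_lbrN a b : Diff_lbr a b = - Diff_lbr b a.
Proof. by rewrite /Diff_lbr opprB mulrC [X in _ - X]mulrC. Qed.

Fact Diff_lbr_linearl b : linear (Diff_lbr^~ b).
Proof.
move=> c u v; rewrite Diff_lbrN Diff_lbr_linearr (Diff_lbrN u) (Diff_lbrN v).
by rewrite scalerN opprD.
Qed.

Fact Diff_lbrxx a : Diff_lbr a a = 0.
Proof. by rewrite /Diff_lbr mulrC subrr. Qed.

Fact Diff_lbr_jacobi a b c :
  Diff_lbr a (Diff_lbr b c) + Diff_lbr b (Diff_lbr c a)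
    + Diff_lbr c (Diff_lbr a b) = 0.
Proof.
have derB (u v : A) : der (u - v) = der u - der v.
  by rewrite addrC -scaleN1r der_linear scaleN1r addrC.
rewrite /Diff_lbr !derB !derM.
have jacobi (x y z x1 y1 z1 x2 y2 z2 : A) :
    (x * (y1 * z1 + y * z2 - (y2 * z + y1 * z1)) - x1 * (y * z1 - y1 * z))
  + (y * (z1 * x1 + z * x2 - (z2 * x + z1 * x1)) - y1 * (z * x1 - z1 * x))
  + (z * (x1 * y1 + x * y2 - (x2 * y + x1 * y1)) - z1 * (x * y1 - x1 * y)) = 0.
  by ring.
exact: jacobi.
Qed.

HB.instance Definition _ := Lmodule_isLie.Build k (Diff A)
  Diff_lbr_linearl Diff_lbr_linearr Diff_lbrxx Diff_lbr_jacobi.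

End Diff.

(* f : fps k is the series \sum_n f n x^n. *)
Definition fps (k : fieldType) : Type := nat -> k.

Section PowerSeries.
Variable k : fieldType.
Implicit Types f g h : fps k.

HB.instance Definition _ := GRing.Lmodule.copy (fps k) (nat -> k^o).

Definition fps_one : fps k := fun n => (n == 0)%:R.

Definition fps_mul f g : fps k := fun n => \sum_(i < n.+1) f i * g (n - i)%N.

Definition fps_der f : fps k := fun n => f n.+1 *+ n.+1.

Let trunc N f : {poly k} := \poly_(i < N) f i.

Let fps_mul_trunc N f g n : (n < N)%N ->
  fps_mul f g n = (trunc N f * trunc N g)`_n.
Proof.
move=> ltnN; rewrite coefM; apply: eq_bigr => i _.
rewrite !coef_poly (leq_ltn_trans (leq_ord i) ltnN).
by rewrite (leq_ltn_trans (leq_subr _ _) ltnN).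
Qed.

Fact fps_mulC : commutative fps_mul.
Proof.
by move=> f g; apply/funext => n; rewrite !(@fps_mul_trunc n.+1) // mulrC.
Qed.

Fact fps_mulA : associative fps_mul.
Proof.
have aux f g h n :
  fps_mul (fps_mul f g) h n = (trunc n.+1 f * trunc n.+1 g * trunc n.+1 h)`_n.
  rewrite coefM; apply: eq_bigr => i _.
  by rewrite (@fps_mul_trunc n.+1) // coef_poly ltnS leq_subr.
move=> f g h; apply/funext => n; rewrite (fps_mulC f) !aux.
by rewrite (mulrC _ (trunc _ f)) mulrA.
Qed.

Fact fps_mul1 : left_id fps_one fps_mul.
Proof.
move=> f; apply/funext => n; rewrite /fps_mul big_ord_recl mul1r subn0.
by rewrite big1 ?addr0 // => i _; rewrite mul0r.
Qed.

Fact fps_mulDl : left_distributive fps_mul +%R.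
Proof.
move=> f g h; apply/funext => n.
transitivity (\sum_(i < n.+1) (f i * h (n - i)%N + g i * h (n - i)%N)).
  by apply: eq_bigr => i _; rewrite -mulrDl.
by rewrite big_split.
Qed.

Fact fps_one_neq0 : fps_one != 0.
Proof.
by apply/eqP => /(congr1 (@^~ 0%N)) /eqP; rewrite /fps_one /= oner_eq0.
Qed.

HB.instance Definition _ := GRing.Zmodule_isComNzRing.Build (fps k)
  fps_mulA fps_mulC fps_mul1 fps_mulDl fps_one_neq0.

Fact fps_scaleAl (a : k) f g : a *: (f * g) = (a *: f) * g.
Proof.
apply/funext => n; transitivity (\sum_(i < n.+1) a * (f i * g (n - i)%N)).
  by rewrite -mulr_sumr.
by apply: eq_bigr => i _; rewrite mulrA.
Qed.

HB.instance Definition _ := GRing.Lmodule_isLalgebra.Build k (fps k) fps_scaleAl.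
HB.instance Definition _ := GRing.Lalgebra_isComAlgebra.Build k (fps k).

Fact fps_der_linear : linear fps_der.
Proof.
move=> a f g; apply/funext => n.
have E : (a * f n.+1 + g n.+1) *+ n.+1
    = a * (f n.+1 *+ n.+1) + g n.+1 *+ n.+1 :> k by rewrite mulrnDl mulrnAr.
exact: E.
Qed.

Fact fps_derM f g : fps_der (f * g) = fps_der f * g + f * fps_der g.
Proof.
apply/funext => n.
have E : fps_mul f g n.+1 *+ n.+1
    = fps_mul (fps_der f) g n + fps_mul f (fps_der g) n :> k.
  rewrite (@fps_mul_trunc n.+2) // -coef_deriv derivM coefD !coefM.
  congr (_ + _); apply: eq_bigr => -[i /= lein] _;
    rewrite coef_deriv !coef_poly !ltnS ?subSS ?leq_subr ?(leqW (leq_subr _ _)).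
    by rewrite -ltnS lein.
  by rewrite leqW.
exact: E.
Qed.

HB.instance Definition _ := ComAlgebra_hasDerivation.Build k (fps k)
  fps_der_linear fps_derM.

End PowerSeries.

Definition W1tilde (k : fieldType) : lieAlgType k := Diff (fps k).

(* The free Lie algebra over k on a set X is built as the quotient of the
   formal expressions in the Lie algebra operations by the least congruence
   that forces the Lie algebra axioms. *)
Section LieTerms.
Variables (k : fieldType) (X : Type).

Inductive lie_term : Type :=
  | LVar of X
  | LZero
  | LAdd of lie_term & lie_term
  | LScale of k & lie_term
  | LBr of lie_term & lie_term.

Inductive lie_cong : lie_term -> lie_term -> Prop :=
  | LC_refl t : lie_cong t t
  | LC_sym s t : lie_cong s t -> lie_cong t s
  | LC_trans s t u : lie_cong s t -> lie_cong t u -> lie_cong s u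
  | LC_add s s' t t' : lie_cong s s' -> lie_cong t t' ->
      lie_cong (LAdd s t) (LAdd s' t')
  | LC_scale a t t' : lie_cong t t' -> lie_cong (LScale a t) (LScale a t')
  | LC_br s s' t t' : lie_cong s s' -> lie_cong t t' ->
      lie_cong (LBr s t) (LBr s' t')
  | LC_addA s t u : lie_cong (LAdd s (LAdd t u)) (LAdd (LAdd s t) u)
  | LC_addC s t : lie_cong (LAdd s t) (LAdd t s)
  | LC_add0 t : lie_cong (LAdd LZero t) t
  | LC_addN t : lie_cong (LAdd (LScale (-1) t) t) LZero
  | LC_scaleA a b t : lie_cong (LScale a (LScale b t)) (LScale (a * b) t)
  | LC_scale1 t : lie_cong (LScale 1 t) t
  | LC_scaleDr a s t :
      lie_cong (LScale a (LAdd s t)) (LAdd (LScale a s) (LScale a t))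
  | LC_scaleDl a b t :
      lie_cong (LScale (a + b) t) (LAdd (LScale a t) (LScale b t))
  | LC_brl a s t u :
      lie_cong (LBr (LAdd (LScale a s) t) u) (LAdd (LScale a (LBr s u)) (LBr t u))
  | LC_brr a s t u :
      lie_cong (LBr u (LAdd (LScale a s) t)) (LAdd (LScale a (LBr u s)) (LBr u t))
  | LC_brxx t : lie_cong (LBr t t) LZero
  | LC_jacobi s t u :
      lie_cong (LAdd (LAdd (LBr s (LBr t u)) (LBr t (LBr u s))) (LBr u (LBr s t)))
        LZero.

HB.instance Definition _ := gen_eqMixin lie_term.
HB.instance Definition _ := gen_choiceMixin lie_term.

Definition lie_congb : rel lie_term := fun s t => `[< lie_cong s t >].

Fact lie_congb_equiv : equiv_class_of lie_congb.
Proof.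
split=> [t|s t|t s u].
- by apply/asboolP/LC_refl.
- by apply/asboolP/asboolP; apply: LC_sym.
- by move=> /asboolP st /asboolP tu; apply/asboolP/(LC_trans st tu).
Qed.

Canonical lie_congb_rel := EquivRelPack lie_congb_equiv.

Definition free_lie : Type := {eq_quot lie_congb_rel}.

HB.instance Definition _ := Choice.on free_lie.
HB.instance Definition _ := EqQuotient.on free_lie.

End LieTerms.
Arguments LZero {k X}.
Arguments LVar {k X}.

Section FreeLie.
Variables (k : fieldType) (X : Type).
Local Notation term := (lie_term k X).
Local Notation F := (free_lie k X).
Implicit Types x y z : F.

Definition free_zero : F := \pi_F LZero.
Definition free_add x y : F := \pi_F (LAdd (repr x) (repr y)).
Definition free_scale a x : F := \pi_F (LScale a (repr x)).
Definition free_opp x : F := free_scale (-1) x.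
Definition free_lbr x y : F := \pi_F (LBr (repr x) (repr y)).
Definition free_var (i : X) : F := \pi_F (LVar i).

Lemma free_piP (s t : term) : \pi_F s = \pi_F t <-> lie_cong s t.
Proof.
split=> [/eqmodP /asboolP //|st].
by apply/eqmodP/asboolP.
Qed.

Let reprP (t : term) : lie_cong (repr (\pi_F t)) t.
Proof. by apply/free_piP; rewrite reprK. Qed.

Lemma free_addP s t : free_add (\pi_F s) (\pi_F t) = \pi_F (LAdd s t).
Proof. by apply/free_piP/LC_add; apply: reprP. Qed.

Lemma free_scaleP a t : free_scale a (\pi_F t) = \pi_F (LScale a t).
Proof. by apply/free_piP/LC_scale; apply: reprP. Qed.

Lemma free_lbrP s t : free_lbr (\pi_F s) (\pi_F t) = \pi_F (LBr s t).
Proof. by apply/free_piP/LC_br; apply: reprP. Qed.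

Fact free_addA : associative free_add.
Proof.
elim/quotW=> s; elim/quotW=> t; elim/quotW=> u; rewrite (free_addP t) (free_addP s t) !free_addP.
exact/free_piP/LC_addA.
Qed.

Fact free_addC : commutative free_add.
Proof.
by elim/quotW=> s; elim/quotW=> t; rewrite !free_addP; apply/free_piP/LC_addC.
Qed.

Fact free_add0 : left_id free_zero free_add.
Proof. by elim/quotW=> t; rewrite free_addP; apply/free_piP/LC_add0. Qed.

Fact free_addN : left_inverse free_zero free_opp free_add.
Proof.
by elim/quotW=> t; rewrite /free_opp free_scaleP free_addP; apply/free_piP/LC_addN.
Qed.

HB.instance Definition _ := GRing.isZmodule.Build F
  free_addA free_addC free_add0 free_addN.

Fact free_scaleA a b x : free_scale a (free_scale b x) = free_scale (a * b) x.
Proof. by elim/quotW: x => t; rewrite (free_scaleP b) !free_scaleP; apply/free_piP/LC_scaleA. Qed.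

Fact free_scale1 : left_id 1 free_scale.
Proof. by elim/quotW=> t; rewrite free_scaleP; apply/free_piP/LC_scale1. Qed.

Fact free_scaleDr : right_distributive free_scale +%R.
Proof.
move=> a; elim/quotW=> s; elim/quotW=> t.
rewrite -[X in free_scale a X]/(free_add (\pi_F s) (\pi_F t)).
rewrite -[RHS]/(free_add (free_scale a (\pi_F s)) (free_scale a (\pi_F t))).
rewrite (free_addP s t) !free_scaleP free_addP.
exact/free_piP/LC_scaleDr.
Qed.

Fact free_scaleDl x : {morph free_scale^~ x : a b / a + b}.
Proof.
elim/quotW: x => t a b; rewrite -[RHS]/(free_add (free_scale a _) (free_scale b _)).
rewrite !free_scaleP free_addP.
exact/free_piP/LC_scaleDl.
Qed.

HB.instance Definition _ := GRing.Zmodule_isLmodule.Build k F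
  free_scaleA free_scale1 free_scaleDr free_scaleDl.

Let linE (a : k) x y : a *: x + y = free_add (free_scale a x) y.
Proof. by []. Qed.

Fact free_lbr_linearl y : linear (free_lbr^~ y).
Proof.
elim/quotW: y => u a; elim/quotW=> s; elim/quotW=> t.
rewrite !linE (free_scaleP a s) (free_addP _ t) !free_lbrP free_scaleP free_addP.
exact/free_piP/LC_brl.
Qed.

Fact free_lbr_linearr x : linear (free_lbr x).
Proof.
elim/quotW: x => u a; elim/quotW=> s; elim/quotW=> t.
rewrite !linE (free_scaleP a s) (free_addP _ t) !free_lbrP free_scaleP free_addP.
exact/free_piP/LC_brr.
Qed.

Fact free_lbrxx x : free_lbr x x = 0.
Proof. by elim/quotW: x => t; rewrite free_lbrP; apply/free_piP/LC_brxx. Qed.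

Fact free_lbr_jacobi x y z :
  free_lbr x (free_lbr y z) + free_lbr y (free_lbr z x)
    + free_lbr z (free_lbr x y) = 0.
Proof.
elim/quotW: x => s; elim/quotW: y => t; elim/quotW: z => u.
rewrite (free_lbrP t u) (free_lbrP u s) (free_lbrP s t) !free_lbrP.
rewrite -[LHS]/(free_add (free_add _ _) _) (free_addP (LBr s _)) free_addP.
exact/free_piP/LC_jacobi.
Qed.

HB.instance Definition _ := Lmodule_isLie.Build k F
  free_lbr_linearl free_lbr_linearr free_lbrxx free_lbr_jacobi.

End FreeLie.

Section Substitution.
Variables (k : fieldType) (X : Type) (L : lieAlgType k) (l : X -> L).

Fixpoint lie_term_eval (t : lie_term k X) : L :=
  match t with
  | LVar i => l i
  | LZero => 0
  | LAdd s t => lie_term_eval s + lie_term_eval t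
  | LScale a t => a *: lie_term_eval t
  | LBr s t => lbr (lie_term_eval s) (lie_term_eval t)
  end.

Definition lie_subst (f : free_lie k X) : L := lie_term_eval (repr f).

Lemma lie_term_eval_cong s t :
  lie_cong s t -> lie_term_eval s = lie_term_eval t.
Proof.
elim=> {s t} /=; try by move=> *; congruence.
- by move=> *; rewrite addrA.
- by move=> *; rewrite addrC.
- by move=> *; rewrite add0r.
- by move=> *; rewrite scaleN1r addNr.
- by move=> *; rewrite scalerA.
- by move=> *; rewrite scale1r.
- by move=> *; rewrite scalerDr.
- by move=> *; rewrite scalerDl.
- by move=> *; rewrite lbr_linearl.
- by move=> *; rewrite lbr_linearr.
- by move=> *; rewrite lbrxx.
- by move=> *; rewrite lbr_jacobi.
Qed.

(* lie_subst is the unique Lie algebra morphism that extends l: this is the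
   universal property of the free Lie algebra. *)
Lemma lie_subst_pi t : lie_subst (\pi_(free_lie k X) t) = lie_term_eval t.
Proof. by apply/lie_term_eval_cong/free_piP; rewrite reprK. Qed.

Lemma lie_subst_var i : lie_subst (free_var k i) = l i.
Proof. exact: lie_subst_pi. Qed.

Lemma lie_subst_linear : linear lie_subst.
Proof.
move=> a x y.
by rewrite [LHS]lie_subst_pi /= [X in X + _]lie_subst_pi.
Qed.

Lemma lie_subst_lbr x y : lie_subst (lbr x y) = lbr (lie_subst x) (lie_subst y).
Proof. exact: lie_subst_pi. Qed.

Lemma lie_subst_unique (phi : free_lie k X -> L) :
    linear phi -> {morph phi : x y / lbr x y} ->
    (forall i, phi (free_var k i) = l i) -> phi =1 lie_subst.
Proof.
move=> philin phibr phivar; elim/quotW => t; rewrite lie_subst_pi.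
have phi0 : phi 0 = 0.
  by have := philin (-1) 0 0; rewrite scaler0 addr0 scaleN1r addNr.
have phiD x y : phi (x + y) = phi x + phi y.
  by have := philin 1 x y; rewrite !scale1r.
have phiZ a x : phi (a *: x) = a *: phi x.
  by have := philin a x 0; rewrite phi0 !addr0.
elim: t => [i||s IHs t IHt|a t IHt|s IHs t IHt] /=.
- exact: phivar.
- exact: phi0.
- by rewrite -IHs -IHt -phiD; congr phi; rewrite -[RHS]/(free_add _ _) free_addP.
- by rewrite -IHt -phiZ; congr phi; rewrite -[RHS]/(free_scale _ _) free_scaleP.
- by rewrite -IHs -IHt -phibr; congr phi; rewrite -[RHS]/(free_lbr _ _) free_lbrP.
Qed.

End Substitution.

(* Main.v *)
(* The main tool is a realization principle.  If lam is a linear map from L to a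
   commutative algebra R with
     lam(x) lam([y, z]) + lam(y) lam([z, x]) + lam(z) lam([x, y]) = 0
   (that is, if its kernel is a subalgebra of codimension one over R), then for
   fixed e the power series sum_j lam((ad e)^j x) T^j / j! satisfy
   lam(e) p_[x,y] = p_x p_y' - p_x' p_y.  Up to powers of lam(e), which are
   constants, this is a homomorphism to special derivations, so an identity f of
   W1tilde satisfies lam(e)^N lam(f(l)) = 0, with N depending only on f.

   The identity St_5 provides such maps.  It says that the operators
   w = s_3(ad a, ad b, ad c) satisfy [w x, y] + [x, w y] = 2 w [x, y], and any w
   with this property commutes with all s_3(ad a, ad b, ad c).  Then
   lam(x) = [ad x, w] is as above.  Semiprimeness turns the resulting nilpotency
   into [ad f(l), w] = 0, so that f(l) lies in the ideal J on which the
   operators w are scalars.  There the alternating form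
   om a b c = s_3(ad a, ad b, ad c) makes L look like a form of sl_2: if h and n
   are such that [h, n] = s n, then lam(x) = om x h n is again as above, and
   such an n exists after adjoining a square root s. *)
From HB Require Import structures.
Require Import Defs.
From mathcomp Require Import all_boot all_order perm all_algebra.
From mathcomp Require Import boolp classical_sets functions.
From mathcomp Require Import ring.
Set Implicit Arguments.
Unset Strict Implicit.
Unset Printing Implicit Defensive.
Import GRing.Theory.
Local Open Scope ring_scope.

(** * Normalization of Lie polynomials *)

HB.instance Definition _ (k : fieldType) (L : lieAlgType k) (x : L) :=
  GRing.isLinear.Build k L L *:%R (lbr x) (lbr_linearr x).

Section LieBasics.
Variables (k : fieldType) (L : lieAlgType k).
Implicit Types x y z : L.

Lemma lbrDr x y z : lbr x (y + z) = lbr x y + lbr x z.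
Proof. exact: linearD. Qed.

Lemma lbrZr (a : k) x y : lbr x (a *: y) = a *: lbr x y.
Proof. exact: linearZ. Qed.

Lemma lbrNr x y : lbr x (- y) = - lbr x y.
Proof. exact: linearN. Qed.

Lemma lbr0r x : lbr x 0 = 0.
Proof. exact: linear0. Qed.

Lemma lbrDl x y z : lbr (x + y) z = lbr x z + lbr y z.
Proof. by have := lbr_linearl z 1 x y; rewrite !scale1r. Qed.

Lemma lbrC x y : lbr x y = - lbr y x.
Proof.
have := lbrxx (x + y).
by rewrite lbrDl !lbrDr !lbrxx add0r addr0 => /eqP; rewrite addr_eq0 => /eqP.
Qed.

Lemma lbrNl x y : lbr (- x) y = - lbr x y.
Proof. by rewrite lbrC lbrNr -lbrC. Qed.

Lemma lbrZl (a : k) x y : lbr (a *: x) y = a *: lbr x y.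
Proof. by rewrite lbrC lbrZr -scalerN -lbrC. Qed.

Lemma lbr0l y : lbr 0 y = 0 :> L.
Proof. by rewrite lbrC lbr0r oppr0. Qed.

Lemma lbr_lbrl x y z : lbr (lbr x y) z = lbr x (lbr y z) - lbr y (lbr x z).
Proof.
have := lbr_jacobi x y z.
rewrite (lbrC z (lbr x y)) => /eqP; rewrite subr_eq0 => /eqP <-.
by rewrite (lbrC x z) lbrNr opprK.
Qed.

End LieBasics.

(* Once a Lie monomial is rooted at one of its letters z, it is a combination
   of words of operators ad x applied to z.  This normal form decides the
   identities all of whose monomials are linear in one of the chosen roots. *)
Module LieTac.

Inductive lexp :=
  | LX of nat | L0 | LA of lexp & lexp | LN of lexp | LB of lexp & lexp.

(** The sign, with [true] for minus, a word of operators, and the letter they act on, or [tt] for a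
    bare operator. *)
Definition sword (T : Type) : Type := (bool * (seq nat * T))%type.

Definition neg T (s : seq (sword T)) : seq (sword T) :=
  [seq (~~ w.1, w.2) | w <- s].

Definition mul T (s : seq (sword unit)) (t : seq (sword T)) : seq (sword T) :=
  flatten [seq [seq (addb u.1 v.1, (u.2.1 ++ v.2.1, v.2.2)) | v <- t] | u <- s].

Fixpoint opw (e : lexp) : seq (sword unit) :=
  match e with
  | LX i => [:: (false, ([:: i], tt))]
  | L0 => [::]
  | LA e f => opw e ++ opw f
  | LN e => neg (opw e)
  | LB e f => mul (opw e) (opw f) ++ neg (mul (opw f) (opw e))
  end.

Fixpoint actw (zs : seq nat) (e : lexp) : option (seq (sword nat)) :=
  match e with
  | LX i => if i \in zs then Some [:: (false, ([::], i))] else None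
  | L0 => Some [::]
  | LA e f => if actw zs e is Some s then
                if actw zs f is Some t then Some (s ++ t) else None
              else None
  | LN e => if actw zs e is Some s then Some (neg s) else None
  | LB e f => if actw zs f is Some t then Some (mul (opw e) t) else
              if actw zs e is Some s then Some (neg (mul (opw f) s)) else None
  end.

Definition pos T (s : seq (sword T)) := [seq w.2 | w <- s & ~~ w.1].

Definition check (zs : seq nat) (e : lexp) : bool :=
  if actw zs e is Some s then perm_eq (pos s) (pos (neg s)) else false.

Section Sound.
Variables (k : fieldType) (L : lieAlgType k) (env : nat -> L).

Fixpoint eval (e : lexp) : L :=
  match e with
  | LX i => env i
  | L0 => 0
  | LA e f => eval e + eval f
  | LN e => - eval e
  | LB e f => lbr (eval e) (eval f)
  end.

Definition wact (w : seq nat) (u : L) : L := foldr (fun i => lbr (env i)) u w.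

Section Act.
Variables (T : Type) (r : T -> L).

Definition sact (s : seq (sword T)) : L :=
  \sum_(w <- s) (if w.1 then - wact w.2.1 (r w.2.2) else wact w.2.1 (r w.2.2)).

Lemma sact_cat s t : sact (s ++ t) = sact s + sact t.
Proof. exact: big_cat. Qed.

Lemma sact_neg s : sact (neg s) = - sact s.
Proof.
rewrite /sact big_map -sumrN; apply: eq_bigr => -[[] w] _ //=.
by rewrite opprK.
Qed.

Lemma wact_sum w s :
  wact w (sact s) = \sum_(v <- s) (if v.1 then - wact w (wact v.2.1 (r v.2.2))
                                    else wact w (wact v.2.1 (r v.2.2))).
Proof.
elim: w => //= i w ->; rewrite linear_sum; apply: eq_bigr => -[[] v] _ //=.
by rewrite lbrNr.
Qed.

Lemma sact_pos s :
  sact s = \sum_(w <- pos s) wact w.1 (r w.2)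
         - \sum_(w <- pos (neg s)) wact w.1 (r w.2).
Proof.
elim: s => [|[b w] s IH]; first by rewrite /sact /= !big_nil subrr.
rewrite /sact big_cons -/(sact s) IH /pos.
by case: b => /=; rewrite big_cons ?opprD; [rewrite addrCA | rewrite addrA].
Qed.

End Act.

Lemma sact_mul T (r : T -> L) s t :
  sact r (mul s t) = sact (fun=> sact r t) s.
Proof.
rewrite /mul {1}/sact big_flatten big_map; apply: eq_bigr => -[b [w []]] _ /=.
rewrite wact_sum big_map; case: b => /=; last first.
  by apply: eq_bigr => -[[] v] _ //=; rewrite /wact foldr_cat.
rewrite -sumrN; apply: eq_bigr => -[[] v] _ //=; rewrite /wact foldr_cat //.
by rewrite opprK.
Qed.

Lemma opwP e u : lbr (eval e) u = sact (fun=> u) (opw e).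
Proof.
elim: e u => [i||e IHe f IHf|e IHe|e IHe f IHf] u /=.
- by rewrite /sact big_seq1.
- by rewrite /sact big_nil lbr0l.
- by rewrite sact_cat lbrDl IHe IHf.
- by rewrite sact_neg lbrNl IHe.
- by rewrite sact_cat sact_neg !sact_mul lbr_lbrl !(IHe, IHf).
Qed.

Lemma actwP zs e s : actw zs e = Some s -> eval e = sact env s.
Proof.
elim: e s => [i||e IHe f IHf|e IHe|e IHe f IHf] s /=.
- by case: ifP => // _ [<-]; rewrite /sact big_seq1.
- by move=> [<-]; rewrite /sact big_nil.
- case: actw IHe => // s1 /(_ _ erefl) ->.
  by case: actw IHf => // s2 /(_ _ erefl) -> [<-]; rewrite sact_cat.
- by case: actw IHe => // s1 /(_ _ erefl) -> [<-]; rewrite sact_neg.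
- case: (actw zs f) IHf => [t|_] => [/(_ _ erefl) -> [<-]|].
    by rewrite opwP sact_mul.
  case: actw IHe => // s1 /(_ _ erefl) -> [<-].
  by rewrite sact_neg sact_mul lbrC opwP.
Qed.

Lemma check_eq zs e f : check zs (LA e (LN f)) -> eval e = eval f.
Proof.
rewrite /check; case E: actw => [s|] // ps; apply/eqP; rewrite -subr_eq0.
by rewrite -[_ - _]/(eval (LA e (LN f))) (actwP E) sact_pos (perm_big _ ps) subrr.
Qed.

End Sound.

Ltac same_atom x y :=
  match constr:(tt) with
  | _ => let _ := match goal with _ => unify x y end in constr:(true)
  | _ => constr:(false)
  end.

Ltac mem_atom x l :=
  lazymatch l with
  | nil => constr:(false)
  | ?y :: ?l' =>
      let b := same_atom x y in
      lazymatch b with true => constr:(true) | false => mem_atom x l' end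
  end.

Ltac index_atom x l :=
  lazymatch l with
  | ?y :: ?l' =>
      let b := same_atom x y in
      lazymatch b with
      | true => constr:(0%N)
      | false => let n := index_atom x l' in constr:(S n)
      end
  end.

Ltac atoms t l :=
  lazymatch t with
  | @GRing.add _ ?a ?b => let l1 := atoms a l in atoms b l1
  | @GRing.opp _ ?a => atoms a l
  | @GRing.zero _ => l
  | @lbr _ _ ?a ?b => let l1 := atoms a l in atoms b l1
  | _ => let b := mem_atom t l in
         lazymatch b with true => l | false => constr:(t :: l) end
  end.

Ltac reify t l :=
  lazymatch t with
  | @GRing.add _ ?a ?b =>
      let a' := reify a l in let b' := reify b l in constr:(LA a' b')
  | @GRing.opp _ ?a => let a' := reify a l in constr:(LN a')
  | @GRing.zero _ => constr:(L0)
  | @lbr _ _ ?a ?b =>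
      let a' := reify a l in let b' := reify b l in constr:(LB a' b')
  | _ => let n := index_atom t l in constr:(LX n)
  end.

Ltac indices zs l :=
  lazymatch zs with
  | nil => constr:(@nil nat)
  | ?z :: ?zs' =>
      let n := index_atom z l in let ns := indices zs' l in constr:(n :: ns)
  end.

Ltac lie_tac zs :=
  lazymatch goal with
  | |- @eq ?T ?a ?b =>
      let l := atoms a (@nil T) in
      let l := atoms b l in
      let ns := indices zs l in
      let a' := reify a l in
      let b' := reify b l in
      refine (@check_eq _ _ (nth 0 l) ns a' b' _); vm_compute; reflexivity
  end.

End LieTac.

(* [lie zs] proves an equality in a Lie algebra by normalization with respect
   to the list of atoms zs as roots; [zmod] is the case where no bracket has
   to be expanded. *)
Ltac lie zs := LieTac.lie_tac zs.

Ltac zmod :=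
  lazymatch goal with
  | |- @eq ?T ?a ?b =>
    let l := LieTac.atoms a (@nil T) in
    let l := LieTac.atoms b l in LieTac.lie_tac l
  end.

(** * Half-derivations *)

Section Wronskian.
Variables (k : fieldType) (L : lieAlgType k).
Implicit Types a b c d u v x y z : L.

(* s_3(ad a, ad b, ad c); on special derivations, multiplication by -2 times the
   Wronskian of a, b, c. *)
Definition wron a b c u : L :=
  lbr (lbr b c) (lbr a u) + lbr (lbr c a) (lbr b u) + lbr (lbr a b) (lbr c u).

Lemma wron_linear a b c : linear (wron a b c).
Proof.
move=> t u v; rewrite /wron !(lbrDr, lbrZr) !scalerDr.
by rewrite [RHS]addrACA [X in _ = X + _]addrACA.
Qed.
HB.instance Definition _ a b c :=
  GRing.isLinear.Build k L L *:%R (wron a b c) (wron_linear a b c).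

Lemma wron_cyc a b c u : wron a b c u = wron b c a u.
Proof. rewrite /wron; lie [:: u]. Qed.

Lemma wron_swap a b c u : wron a b c u = - wron b a c u.
Proof. rewrite /wron; lie [:: u]. Qed.

Lemma wronxx a c u : wron a a c u = 0.
Proof. rewrite /wron; lie [:: u]. Qed.

Lemma wron4 a b c v :
  wron a b c v = wron b c v a + wron c a v b + wron a b v c.
Proof. rewrite /wron; lie [:: v]. Qed.

Lemma lbr_wron x a b c u :
  lbr x (wron a b c u) = wron (lbr x a) b c u + wron a (lbr x b) c u
     + wron a b (lbr x c) u + wron a b c (lbr x u).
Proof. rewrite /wron; lie [:: u]. Qed.

(** Sorting permutations by the image of 0, again and again, lists the 24 signed terms of St_5. *)
Lemma sum_perm_recl (n : nat) (V : zmodType) (F : 'S_n.+1 -> V) :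
  \sum_(s : 'S_n.+1) F s =
  \sum_(i < n.+1) \sum_(t : 'S_n) F (lift_perm ord0 i t).
Proof.
rewrite (partition_big (fun s : 'S_n.+1 => s ord0) xpredT) //=.
apply: eq_bigr => i _.
rewrite (reindex (lift_perm ord0 i)); last first.
  (* [ulsf s] deletes 0 and its image from [s]; the default of [odflt] is never reached, since [s]
     is injective. *)
  pose ulsf (s : 'S_n.+1) j := odflt j (unlift (s ord0) (s (lift ord0 j))).
  have ulsfK (s : 'S_n.+1) j : lift (s ord0) (ulsf s j) = s (lift ord0 j).
    rewrite /ulsf; have:= neq_lift ord0 j.
    by rewrite -(can_eq (permK s)) => /unlift_some[] ? ? ->.
  have inj_ulsf s: injective (ulsf s).
    move=> j1 j2 eqj; apply: (@lift_inj _ ord0); apply: (@perm_inj _ s).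
    by rewrite -!ulsfK eqj.
  exists (fun s => perm (inj_ulsf s)) => [s _ | s].
    by apply/permP=> j; rewrite permE /ulsf lift_perm_lift lift_perm_id liftK.
  rewrite inE => /eqP si; apply/permP => j.
  case: (unliftP ord0 j) => [j'|] ->; rewrite ?lift_perm_lift ?lift_perm_id //.
  by rewrite permE -si ulsfK.
by apply: eq_bigl => t; rewrite lift_perm_id eqxx.
Qed.

Lemma sum_perm0 (V : zmodType) (F : 'S_0 -> V) : \sum_(s : 'S_0) F s = F 1%g.
Proof.
rewrite (big_pred1 (1%g : 'S_0)) // => s; apply/esym/eqP/permP => -[].
by [].
Qed.

(* s_4(ad a, ad b, ad c, ad d), grouped by commutators. *)
Definition std4 a b c d u : L :=
  lbr (lbr a b) (lbr (lbr c d) u) + lbr (lbr c d) (lbr (lbr a b) u)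
  - (lbr (lbr a c) (lbr (lbr b d) u) + lbr (lbr b d) (lbr (lbr a c) u))
  + (lbr (lbr a d) (lbr (lbr b c) u) + lbr (lbr b c) (lbr (lbr a d) u)).

Hypothesis LSt5 : standard_lie_identity5 L.

Lemma std4_eq0 a b c d u : std4 a b c d u = 0.
Proof.
pose x (i : 'I_4) := nth 0 [:: a; b; c; d] i.
have := LSt5 x u.
rewrite !sum_perm_recl.
under eq_bigr => i _ do (rewrite sum_perm_recl;
  under eq_bigr => j _ do (rewrite sum_perm_recl;
    under eq_bigr => l _ do (rewrite sum_perm_recl;
    under eq_bigr => m _ do rewrite sum_perm0 !odd_lift_perm odd_perm1 ))).
have e0 : inord 0 = ord0 :> 'I_4 by apply/val_inj; rewrite /= inordK.
have e1 : inord 1 = lift ord0 ord0 :> 'I_4 by apply/val_inj; rewrite /= inordK.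
have e2 : inord 2 = lift ord0 (lift ord0 ord0) :> 'I_4
  by apply/val_inj; rewrite /= inordK.
have e3 : inord 3 = lift ord0 (lift ord0 (lift ord0 ord0)) :> 'I_4
  by apply/val_inj; rewrite /= inordK.
under eq_bigr => i _ do
  under eq_bigr => j _ do
    under eq_bigr => l _ do
    under eq_bigr => m _ do rewrite e0 e1 e2 e3 !lift_perm_lift !lift_perm_id.
rewrite !big_ord_recl !big_ord0.
rewrite /x /ad /= !(expr0, expr1, scale1r, scaleN1r) => <-.
rewrite /std4; lie [:: u].
Qed.

(** The delta-derivations with delta = 1/2, without denominators. On special derivations,
    multiplication by any function is one. *)
Definition half_der (w : L -> L) :=
  forall x y, lbr (w x) y + lbr x (w y) = w (lbr x y) + w (lbr x y).

(** The defect of the rule is a difference of two values of s_4, both zero by St_5. *)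
Lemma wron_half_der a b c : half_der (wron a b c).
Proof.
move=> x y.
transitivity (wron a b c (lbr x y) + wron a b c (lbr x y)
   + (std4 a b c y x - std4 a b c x y)); last by rewrite !std4_eq0 subrr addr0.
rewrite /wron /std4; lie [:: y].
Qed.

Section HalfDer.
Variable w : {linear L -> L}.
Hypothesis w_half : half_der w.

Lemma half_der_lbr2 x y z :
  w (lbr x (lbr y z)) + w (lbr x (lbr y z))
    + (w (lbr x (lbr y z)) + w (lbr x (lbr y z))) =
  lbr (w x) (lbr y z) + lbr (w x) (lbr y z) + lbr x (lbr (w y) z)
    + lbr x (lbr y (w z)).
Proof.
by rewrite -(w_half x) addrACA -(lbrDr x) -w_half lbrDr addrA.
Qed.

(** Apply 4 [w] to the Jacobi identity and expand by [half_der_lbr2]; the double brackets that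
    contain [w x], say, combine into one by Jacobi. *)
Lemma half_der_jacobi x y z :
  lbr (w x) (lbr y z) + lbr (w y) (lbr z x) + lbr (w z) (lbr x y) = 0.
Proof.
have := congr1 w (lbr_jacobi x y z); rewrite !linearD linear0 => e.
have := congr2 +%R (congr2 +%R e e) (congr2 +%R e e); rewrite !addr0.
pose d x y z := w (lbr x (lbr y z)).
have E : forall p q r : L, p + q + r + (p + q + r) + (p + q + r + (p + q + r)) =
  p + p + (p + p) + (q + q + (q + q)) + (r + r + (r + r)) by move=> p q r; zmod.
rewrite E !half_der_lbr2 => <-; lie [:: z; w z].
Qed.


(** Multiples by powers of 2 are spelled additively because [lie] and [zmod] treat no scalars. *)
Let dbl (u : L) := u + u.

Let dbl3D u v :
  dbl (dbl (dbl (u + v))) = dbl (dbl (dbl u)) + dbl (dbl (dbl v)).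
Proof. by rewrite /dbl; zmod. Qed.

Let dbl3N u : dbl (dbl (dbl (- u))) = - dbl (dbl (dbl u)).
Proof. by rewrite /dbl; zmod. Qed.

Let half_der_lbr3 p q r s : dbl (dbl (dbl (w (lbr p (lbr (lbr q r) s))))) =
  dbl (dbl (lbr (w p) (lbr (lbr q r) s))) + lbr p (lbr (lbr (w q) r) s)
    + lbr p (lbr (lbr q (w r)) s) + dbl (lbr p (lbr (lbr q r) (w s))).
Proof.
rewrite /dbl half_der_lbr2.
have : lbr p (lbr (lbr (w q) r) s) + lbr p (lbr (lbr q (w r)) s) =
          lbr p (lbr (w (lbr q r)) s) + lbr p (lbr (w (lbr q r)) s).
  by rewrite -!lbrDr -!lbrDl w_half !(lbrDl, lbrDr).
move/(canRL (addrK _)) ->; zmod.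
Qed.

Let half_der_lbr3' p q r s : dbl (dbl (dbl (w (lbr p (lbr q (lbr r s)))))) =
  dbl (dbl (lbr (w p) (lbr q (lbr r s)))) + dbl (lbr p (lbr (w q) (lbr r s)))
    + lbr p (lbr q (lbr (w r) s)) + lbr p (lbr q (lbr r (w s))).
Proof.
rewrite /dbl half_der_lbr2.
have : lbr p (lbr q (lbr (w r) s)) + lbr p (lbr q (lbr r (w s))) =
          lbr p (lbr q (w (lbr r s))) + lbr p (lbr q (w (lbr r s))).
  by rewrite -!lbrDr w_half.
move/(canRL (addrK _)) ->; zmod.
Qed.

Hypothesis char0 : [pchar k] =i pred0.

Lemma dbl_inj : injective dbl.
Proof.
move=> u v; rewrite /dbl -!mulr2n -!scaler_nat; apply: scalerI.
by move/pcharf0P: char0 => ->.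
Qed.

(* Moving w inside s_3 by the Leibniz rule in two different ways gives two
   expressions for 8 w (wron a b c x). *)
Lemma half_der_wron a b c x : w (wron a b c x) = wron a b c (w x).
Proof.
(* In [P], [Q] and [T] the operator [w] falls on the outermost, middle and innermost letter of the
   alternating sum. *)
pose P := lbr (w a) (lbr (lbr b c) x) + lbr (w b) (lbr (lbr c a) x)
        + lbr (w c) (lbr (lbr a b) x).
pose Q := lbr a (lbr (w b) (lbr c x)) - lbr b (lbr (w a) (lbr c x))
        + lbr b (lbr (w c) (lbr a x)) - lbr c (lbr (w b) (lbr a x))
        + lbr c (lbr (w a) (lbr b x)) - lbr a (lbr (w c) (lbr b x)).
pose T := lbr (lbr a b) (lbr (w c) x) + lbr (lbr b c) (lbr (w a) x)
        + lbr (lbr c a) (lbr (w b) x).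
have J := half_der_jacobi.
have PQ : P = Q.
  have h p q r : lbr (lbr (w p) q) r + lbr (lbr p (w q)) r
      - (lbr (w (lbr p q)) r + lbr (w (lbr p q)) r) = 0.
    by rewrite -!lbrDl w_half subrr.
  apply/eqP; rewrite -subr_eq0; apply/eqP.
  have := congr2 +%R (congr2 +%R (h b c (lbr x a)) (h c a (lbr x b)))
                     (h a b (lbr x c)).
  have := congr2 +%R (congr2 +%R (J a (lbr b c) x) (J b (lbr c a) x))
                     (J c (lbr a b) x).
  rewrite !addr0 => e /(congr2 +%R (congr2 +%R e e)); rewrite !addr0 => <-.
  rewrite /P /Q; lie [:: x; w x].
have TP : T = P.
  rewrite -[RHS](subr0 P) -[X in _ - X](lbr0l x) -(J a b c) /T /P.
  lie [:: x].
have e1 : dbl (dbl (dbl (w (wron a b c x)))) =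
    dbl (dbl P) + Q + T + dbl (wron a b c (w x)).
  have -> : wron a b c x = lbr a (lbr (lbr b c) x) + lbr b (lbr (lbr c a) x)
     + lbr c (lbr (lbr a b) x) by rewrite /wron; lie [:: x].
  rewrite !(linearD w) !dbl3D !half_der_lbr3 /P /Q /T /wron /dbl.
  lie [:: x; w x].
have e2 : dbl (dbl (dbl (w (wron a b c x)))) =
    dbl (dbl P) + dbl Q + T + wron a b c (w x).
  have -> : wron a b c x =
       lbr a (lbr b (lbr c x)) + lbr b (lbr c (lbr a x)) + lbr c (lbr a (lbr b x))
     - lbr a (lbr c (lbr b x)) - lbr b (lbr a (lbr c x)) - lbr c (lbr b (lbr a x)).
    by rewrite /wron; lie [:: x].
  rewrite !(linearD w) !(linearN w).
  rewrite !(dbl3D, dbl3N) !half_der_lbr3' /P /Q /T /wron /dbl.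
  lie [:: x; w x].
(* Subtracting the two expansions leaves this; with P = Q = T either expansion then reads 8 Q. *)
have QD : wron a b c (w x) = Q.
  move: e1; rewrite e2 /dbl => /eqP; rewrite -subr_eq0 => /eqP e.
  apply/eqP; rewrite eq_sym -subr_eq0; apply/eqP; rewrite -[RHS]e; zmod.
apply/dbl_inj/dbl_inj/dbl_inj; rewrite e2 QD TP PQ /dbl; zmod.
Qed.
End HalfDer.
End Wronskian.

(** * Polarization of polynomials with vector coefficients *)

Section Polarization.
Variables (k : fieldType) (char0 : [pchar k] =i pred0) (V : lmodType k).

Lemma natf_char0_eq0 n : (n%:R == 0 :> k) = (n == 0%N).
Proof. by move/pcharf0P: char0 => ->. Qed.

(** Passing from t to 2 t and subtracting 2^m times the original removes the top coefficient and
    multiplies the j-th one by 2^j - 2^m, which is nonzero in characteristic zero. *)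
Lemma vect_poly_eq0 m (v : nat -> V) :
  (forall t : k, \sum_(j < m) t ^+ j *: v j = 0) ->
  forall j, (j < m)%N -> v j = 0.
Proof.
elim: m v => // m IH v v0.
have {}IH j : (j < m)%N -> v j = 0.
  move=> jm.
  have nz : 2 ^+ j - 2 ^+ m != 0 :> k.
    rewrite -(subnKC (ltnW jm)) exprD -{1}[2 ^+ j]mulr1 -mulrBr mulf_neq0 //.
      by rewrite expf_neq0 // natf_char0_eq0.
    rewrite -opprB oppr_eq0 -natrX -(@natrB _ _ 1) ?expn_gt0 //.
    by rewrite natf_char0_eq0 -lt0n subn_gt0 -{1}(expn0 2) ltn_exp2l // subn_gt0.
  suff /eqP : (2 ^+ j - 2 ^+ m) *: v j = 0 by rewrite scaler_eq0 (negPf nz) => /eqP.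
  apply: (IH (fun j => (2 ^+ j - 2 ^+ m) *: v j)) => // t.
  have := congr2 (fun x y => x - 2 ^+ m *: y) (v0 (2 * t)) (v0 t).
  rewrite scaler0 subr0 => e; rewrite -[RHS]e !big_ord_recr /= scalerDr opprD.
  rewrite addrACA exprMn !scalerA subrr addr0 scaler_sumr -sumrB.
  apply: eq_bigr => i _; rewrite exprMn !scalerA -scalerBl; congr (_ *: _).
  by rewrite mulrBr mulrC [t ^+ _ * 2 ^+ m]mulrC.
move=> j; rewrite ltnS leq_eqVlt => /predU1P[->|]; last exact: IH.
have := v0 1; rewrite big_ord_recr /= expr1n scale1r big1 ?add0r // => i _.
by rewrite IH ?scaler0.
Qed.

(* [g t = v0 + t v1 + O(t^2)], where [g] is polynomial in [t] *)
Definition jet1 (g : k -> V) (v0 v1 : V) :=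
  exists m (r : nat -> V),
    forall t, g t = v0 + t *: v1 + \sum_(j < m) t ^+ j.+2 *: r j.

Lemma jet1_cst v : jet1 (fun=> v) v 0.
Proof. by exists 0%N, (fun=> 0) => t; rewrite scaler0 big_ord0 !addr0. Qed.

Lemma jet1_step (b b' : {linear V -> V}) g v0 v1 : jet1 g v0 v1 ->
  jet1 (fun t => b (g t) + t *: b' (g t)) (b v0) (b v1 + b' v0).
Proof.
move=> [m [r gE]].
exists m.+1, (fun j => (if (j < m)%N then b (r j) else 0)
                       + b' (if j is i.+1 then r i else v1)) => t.
rewrite gE !linearD /= !linearZ !linear_sum /=.
under [in RHS]eq_bigr do rewrite scalerDr.
rewrite [in RHS]big_split /= [X in _ = _ + (X + _)]big_ord_recr /= ltnn scaler0.
rewrite addr0 [in RHS](big_ord_recl m) /= scalerA -expr2.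
under eq_bigr do rewrite linearZ.
under [\sum_(i < m) t *: b' _]eq_bigr do rewrite linearZ /= scalerA -exprS.
under [X in _ = _ + (X + _)]eq_bigr => i _ do rewrite ltn_ord.
by rewrite -!addrA; congr (_ + (_ + _)); rewrite [LHS]addrCA.
Qed.

Lemma jet1_eq0 g v0 v1 : jet1 g v0 v1 -> (forall t, g t = 0) -> v1 = 0.
Proof.
move=> [m [r gE]] g0.
pose v j := if j is i.+1 then (if i is l.+1 then r l else v1) else v0.
apply: (@vect_poly_eq0 m.+2 v _ 1%N) => // t.
by rewrite !big_ord_recl /= expr0 scale1r expr1 addrA -gE.
Qed.
End Polarization.

(** * Ideals and semiprimeness *)

Section Ideals.
Variables (k : fieldType) (L : lieAlgType k) (Lsemiprime : lie_semiprime L).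

Lemma is_lie_idealP (I : set L) :
  is_lie_ideal I <->
  [/\ I 0, forall u v, I u -> I v -> I (u + v),
      forall (a : k) u, I u -> I (a *: u) & forall x y, I y -> I (lbr x y)].
Proof.
split=> [[[I0 Il] Ib]|[I0 Ia Iz Ib]]; last first.
  by split=> //; split=> // a u v Iu Iv; apply: Ia => //; apply: Iz.
split=> // [u v Iu Iv|a u Iu]; first by rewrite -[u]scale1r; apply: Il.
by rewrite -[_ *: _]addr0; apply: Il.
Qed.

(** Semiprimeness enters the proof only in this form. *)
Lemma abelian_ideal_eq0 (I : set L) : is_lie_ideal I ->
  (forall u v, I u -> I v -> lbr u v = 0) -> forall u, I u -> u = 0.
Proof.
move=> idI abI u Iu; apply: contrapT => u0.
have In0 : I <> [set 0]%classic by move=> I0; move: Iu; rewrite I0.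
apply: (Lsemiprime idI In0); apply/seteqP; split=> v; last first.
  by move=> ->; rewrite /lie_prod => W [[W0 _] _].
apply; split=> [|w [x [y [Ix Iy ->]]]]; last exact: abI.
by split=> // a x y -> ->; rewrite /= scaler0 addr0.
Qed.
End Ideals.

(** * Central half-derivations and their commutators with ad x *)

HB.lock Definition lder (k : fieldType) (L : lieAlgType k) (x : L)
    (w : {linear L -> L}) : {linear L -> L} :=
  (lbr x \o w) \- (w \o lbr x).

Section Center.
Variables (k : fieldType) (char0 : [pchar k] =i pred0) (L : lieAlgType k).
Hypothesis LSt5 : standard_lie_identity5 L.
Implicit Types (x y z u : L) (w v : {linear L -> L}).


Lemma lderE x w u : lder x w u = lbr x (w u) - w (lbr x u).
Proof. by rewrite lder.unlock. Qed.

(** This commutative family contains the [wron a b c] and, by [lder_central], is stable under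
    commutators with ad x. *)
Definition central_half w :=
  half_der w /\
  forall v : {linear L -> L}, half_der v -> forall x, w (v x) = v (w x).

(** Since [lbr x] is a derivation, its commutator with a half-derivation is a half-derivation. *)
Lemma lder_half x w : half_der w -> half_der (lder x w).
Proof.
move=> hw y z; have := congr1 (lbr x) (hw y z); have := hw (lbr x y) z.
have := hw y (lbr x z); rewrite !lderE.
have -> : w (lbr x (lbr y z)) = w (lbr (lbr x y) z) + w (lbr y (lbr x z)).
  by rewrite -linearD; congr (w _); lie [:: z].
move=> /(canRL (addrK _)) e1 /(canRL (addrK _)) e2; rewrite !lbrDr.
move=> /(canRL (addrK _)) e3.
rewrite lbrDl lbrNr lbrNl.
have -> : lbr (lbr x (w y)) z = lbr x (lbr (w y) z) - lbr (w y) (lbr x z).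
  by lie [:: z].
have -> : lbr y (lbr x (w z)) = lbr x (lbr y (w z)) - lbr (lbr x y) (w z).
  by lie [:: w z].
rewrite e3 e2 e1; zmod.
Qed.

(** This is the half-derivation rule rearranged. When [w] multiplies special derivations by a
    function, both sides are x y w'. *)
Lemma lder_sym x y w : half_der w -> lder x w y = lder y w x.
Proof.
move=> hw; have := hw x y; rewrite !lderE [lbr y x]lbrC linearN opprK.
by rewrite [lbr y _]lbrC => /(canRL (addKr _)) ->; zmod.
Qed.

(** Take the commutator of ad x with w v = v w; the half-derivation [lder x v] commutes with [w]
    too. *)
Lemma lder_central x w : central_half w -> central_half (lder x w).
Proof.
move=> [hw cw]; split=> [|v hv y]; first exact: lder_half.
have := cw _ (lder_half x hv) y; rewrite !lderE !linearB /= => /(canRL (subrK _)) ->.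
by rewrite !(cw v) //; zmod.
Qed.

Lemma central_halfC w v x : central_half w -> central_half v -> w (v x) = v (w x).
Proof. by move=> [_ cw] [hv _]; apply: cw. Qed.

(** Alternate the symmetry [lder_sym] with commutation. For multiplications by functions both sides
    are x y u w' v'. *)
Lemma lder_swap x y u w v : central_half w -> central_half v ->
  lder x w (lder y v u) = lder y w (lder x v u).
Proof.
move=> cw cv; have [hw hv] := (cw.1, cv.1).
rewrite (lder_sym y u hv) (central_halfC _ (lder_central x cw) (lder_central u cv)).
rewrite (lder_sym x y hw) -(central_halfC _ (lder_central y cw) (lder_central u cv)).
by rewrite (lder_sym u x hv).
Qed.

Lemma lder_lbr x y w u :
  lder (lbr x y) w u = lder x (lder y w) u - lder y (lder x w) u.
Proof.
rewrite !lderE !linearB /=.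
have -> : lbr (lbr x y) (w u) = lbr x (lbr y (w u)) - lbr y (lbr x (w u))
  by lie [:: w u].
have -> : lbr (lbr x y) u = lbr x (lbr y u) - lbr y (lbr x u) by lie [:: u].
by rewrite linearB /=; zmod.
Qed.

(* The functional [x |-> lder x w] satisfies the relation that makes its kernel
   a subalgebra. *)
Lemma lder_realize w e x y u : central_half w ->
  lder e w (lder (lbr x y) w u) =
  lder x w (lder (lbr e y) w u) - lder (lbr e x) w (lder y w u).
Proof.
move=> cw; have cl := fun x => lder_central x cw.
rewrite !lder_lbr (linearB (lder e w)) (linearB (lder x w)).
rewrite (lder_swap e x u cw (cl y)) (lder_swap e y u cw (cl x)).
have -> : lder e (lder x w) (lder y w u) = lder y w (lder e (lder x w) u).
  by apply: central_halfC; [apply: lder_central | apply: cl].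
have -> : lder x (lder e w) (lder y w u) = lder x w (lder y (lder e w) u).
  rewrite (central_halfC _ (lder_central x (cl e)) (cl y)).
  by rewrite (lder_swap y x).
zmod.
Qed.

Lemma central_half_wron a b c : central_half (wron a b c).
Proof.
split=> [|v hv x]; first exact: wron_half_der.
by rewrite (half_der_wron hv char0).
Qed.

End Center.

Lemma jet1_iter (k : fieldType) (V : lmodType k) (b b' : {linear V -> V})
    (bt : k -> V -> V) z m :
  (forall t u, bt t u = b u + t *: b' u) -> (forall u, b (b' u) = b' (b u)) ->
  jet1 (fun t => iter m (bt t) z) (iter m b z) (m%:R *: b' (iter m.-1 b z)).
Proof.
move=> btE bC; elim: m => [|m IH] /=; first by rewrite scale0r; apply: jet1_cst.
have := jet1_step b b' IH; rewrite linearZ /= bC.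
(* For m = 0 the truncated predecessor does no harm, as the coefficient is 0. *)
have -> : m%:R *: b' (b (iter m.-1 b z)) = m%:R *: b' (iter m b z).
  by case: m {IH} => [|m] //=; rewrite !scale0r.
rewrite -{2}[b' _]scale1r -scalerDl natr1.
by under [X in jet1 X _ _ -> _]eq_fun do rewrite -btE.
Qed.

(** * The ideal J on which all commutators [ad x, w] vanish *)

Section ConstantPart.
Variables (k : fieldType) (char0 : [pchar k] =i pred0) (L : lieAlgType k).
Hypothesis LSt5 : standard_lie_identity5 L.
Hypothesis Lsemiprime : lie_semiprime L.
Implicit Types (x y z u v e : L) (w : {linear L -> L}).

(* On special derivations of a domain with derivation d, lder x w is the
   multiplication by x d(w): const_part detects constant coefficients. *)
Definition const_part : set L :=
  [set z | forall w, central_half w -> forall x, lder x w z = 0]%classic.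

Lemma lbr_lder x e w u :
  lbr x (lder e w u) = lder x (lder e w) u + lder e w (lbr x u).
Proof. by rewrite [lder x _ u]lderE subrK. Qed.

Lemma const_part_ideal : is_lie_ideal const_part.
Proof.
apply/is_lie_idealP; split=> [w _ x|u v Iu Iv w cw x|a u Iu w cw x|x y Iy w cw e].
- exact: linear0.
- by rewrite linearD Iu // Iv // addr0.
- by rewrite linearZ /= Iu // scaler0.
- have := lbr_lder x e w y; rewrite !Iy //; last exact: lder_central.
  by rewrite lbr0r add0r.
Qed.

Lemma const_partD u v : const_part u -> const_part v -> const_part (u + v).
Proof. by have /is_lie_idealP [_ h _ _] := const_part_ideal; apply: h. Qed.

Lemma const_partN u : const_part u -> const_part (- u).
Proof.
have /is_lie_idealP [_ _ h _] := const_part_ideal.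
by move=> Ju; rewrite -scaleN1r; apply: h.
Qed.

Lemma const_partB x u : const_part u -> const_part (lbr x u).
Proof. by have /is_lie_idealP [_ _ _ h] := const_part_ideal; apply: h. Qed.

Lemma const_part_lbrl x y : const_part x -> const_part (lbr x y).
Proof. by move=> Jx; rewrite lbrC; apply/const_partN/const_partB. Qed.

(** The center of the ideal J is an abelian ideal of L. *)
Lemma const_part_center y : const_part y ->
  (forall u, const_part u -> lbr y u = 0) -> y = 0.
Proof.
move=> Jy Cy; have /is_lie_idealP [I0 ID IZ IB] := const_part_ideal.
pose K := [set y | const_part y /\ forall u, const_part u -> lbr y u = 0]%classic.
apply: (@abelian_ideal_eq0 _ _ Lsemiprime K) => [|u v [_ Ku] [Jv _]|//]; last exact: Ku.
apply/is_lie_idealP; split=> [|u v [Ju Ku] [Jv Kv]|a u [Ju Ku]|x u [Ju Ku]].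
- by split=> // u _; rewrite lbr0l.
- by split=> [|z Jz]; [apply: ID | rewrite lbrDl Ku // Kv // addr0].
- by split=> [|z Jz]; [apply: IZ | rewrite lbrZl Ku // scaler0].
- split=> [|z Jz]; first exact: IB.
  by rewrite lbr_lbrl (Ku z) // (Ku (lbr x z)) ?lbr0r ?subrr //; apply: IB.
Qed.

(** For u in J, [lbr_lder] writes the bracket of u with [lder e w v] as two terms that vanish
    because u and [u, v] lie in J. So [lder e w v] is in the center of J. *)
Lemma const_part_lder e w v :
  central_half w -> const_part (lder e w v) -> lder e w v = 0.
Proof.
move=> cw Jv; apply: const_part_center => // u Ju.
rewrite lbrC lbr_lder (lder_sym _ _ (lder_half e cw.1)) Ju ?add0r; last first.
  exact: lder_central.
by rewrite (const_part_lbrl v Ju) // oppr0.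
Qed.

(* Polarizing (lder e w)^(n+1) z = 0 in e and w shows that (lder e w)^n z lies
   in const_part, where it vanishes by semiprimeness. *)
Lemma const_part_descent n z :
  (forall e w, central_half w -> iter n.+1 (lder e w) z = 0) -> const_part z.
Proof.
elim: n => [|n IH] h; first by move=> w cw e; exact: h.
have comm w w' e e' u : central_half w -> central_half w' ->
    lder e w (lder e' w' u) = lder e' w' (lder e w u).
  by move=> cw cw'; apply: central_halfC; apply: lder_central.
have lderDl e e' w u t : lder (e + t *: e') w u = lder e w u + t *: lder e' w u.
  rewrite !lderE !lbrDl !lbrZl linearD linearZ /= scalerBr opprD.
  exact: addrACA.
(* The first-order term in t of the hypothesis at e + t e'. *)
have h1 e e' w : central_half w -> lder e' w (iter n.+1 (lder e w) z) = 0.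
  move=> cw.
  have := jet1_eq0 char0 (@jet1_iter _ _ (lder e w) (lder e' w)
     (fun t => lder (e + t *: e') w) z n.+2 _ _) (fun t => h _ w cw).
  move=> /(_ (fun t u => lderDl _ _ _ u t) (fun u => comm _ _ _ _ _ cw cw)) /eqP.
  by rewrite scaler_eq0 natf_char0_eq0 // => /eqP.
apply: IH => e w cw; apply: const_part_lder => // w' cw' e'.
pose wt t : {linear L -> L} := w \+ t \*: w'.
have cwt t : central_half (wt t).
  split=> [x y|v hv x] /=; last by rewrite cw.2 // cw'.2 // linearD linearZ.
  rewrite lbrDl lbrZl lbrDr lbrZr addrACA cw.1 -scalerDr cw'.1 scalerDr.
  exact: addrACA.
have ltE e1 t u : lder e1 (wt t) u = lder e1 w u + t *: lder e1 w' u.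
  rewrite !lderE /= lbrDr lbrZr scalerBr opprD; exact: addrACA.
have := @jet1_iter _ _ (lder e w) (lder e w') (fun t => lder e (wt t)) z n.+1
  (ltE e) (fun u => comm _ _ _ _ _ cw cw').
move/(jet1_step (lder e' w) (lder e' w')).
move=> /(jet1_eq0 char0).
(* By [lder_swap], each of the n + 1 terms in which w' is paired with e equals the one in which it
   is paired with e'; together they give the factor n + 2. *)
have -> : lder e' w (n.+1%:R *: lder e w' (iter n.+1.-1 (lder e w) z)) =
          n.+1%:R *: lder e' w' (iter n.+1 (lder e w) z).
  by rewrite linearZ /= (lder_swap e') // comm.
rewrite -{2}[lder e' w' _]scale1r -scalerDl natr1 => h2.
have /eqP : n.+2%:R *: lder e' w' (iter n.+1 (lder e w) z) = 0.
  by apply: h2 => t; rewrite -ltE; apply: h1.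
by rewrite scaler_eq0 natf_char0_eq0 // => /eqP.
Qed.

End ConstantPart.

(** * The realization principle *)

Section JetExpressions.
Variables (k : fieldType) (I : eqType).

(* Differential polynomials in the indeterminates [i : I] with an additional
   constant: [JVar (Some (i, j))] is the j-th derivative of i, and [JVar None]
   enters only through [JMulc]. *)
Inductive jexp :=
  | JVar of I & nat
  | JZero
  | JAdd of jexp & jexp
  | JOpp of jexp
  | JScale of k & jexp
  | JMulc of jexp
  | JMul of jexp & jexp.

Fixpoint jder (p : jexp) : jexp :=
  match p with
  | JVar i j => JVar i j.+1
  | JZero => JZero
  | JAdd p q => JAdd (jder p) (jder q)
  | JOpp p => JOpp (jder p)
  | JScale c p => JScale c (jder p)
  | JMulc p => JMulc (jder p)
  | JMul p q => JAdd (JMul (jder p) q) (JMul p (jder q))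
  end.

Fixpoint jeval (R : comNzRingType) (cst : k -> R) (v : option (I * nat) -> R)
    (p : jexp) : R :=
  match p with
  | JVar i j => v (Some (i, j))
  | JZero => 0
  | JAdd p q => jeval cst v p + jeval cst v q
  | JOpp p => - jeval cst v p
  | JScale c p => cst c * jeval cst v p
  | JMulc p => v None * jeval cst v p
  | JMul p q => jeval cst v p * jeval cst v q
  end.

Fixpoint jvars (p : jexp) : seq (option (I * nat)) :=
  match p with
  | JVar i j => [:: Some (i, j)]
  | JZero => [::]
  | JAdd p q | JMul p q => jvars p ++ jvars q
  | JOpp p | JScale _ p => jvars p
  | JMulc p => None :: jvars p
  end.

Lemma jeval_rmorph (R S : comNzRingType) (phi : {rmorphism R -> S}) cst v p :
  phi (jeval cst v p) = jeval (phi \o cst) (phi \o v) p.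
Proof.
elim: p => [i j||p IHp q IHq|p IHp|c p IHp|p IHp|p IHp q IHq] //=.
- by rewrite rmorph0.
- by rewrite rmorphD IHp IHq.
- by rewrite rmorphN IHp.
- by rewrite rmorphM IHp.
- by rewrite rmorphM IHp.
- by rewrite rmorphM IHp IHq.
Qed.

Lemma eq_jeval (R : comNzRingType) (cst cst' : k -> R) v v' p :
  cst =1 cst' -> {in jvars p, v =1 v'} -> jeval cst v p = jeval cst' v' p.
Proof.
move=> ec; elim: p => [i j||p IHp q IHq|p IHp|c p IHp|p IHp|p IHp q IHq] /= ev.
- by apply: ev; rewrite mem_seq1.
- by [].
- by rewrite IHp ?IHq // => x xv; apply: ev; rewrite mem_cat xv ?orbT.
- by rewrite IHp.
- by rewrite IHp // ec.
- by rewrite IHp ?ev ?mem_head // => x xv; apply: ev; rewrite inE xv orbT.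
- by rewrite IHp ?IHq // => x xv; apply: ev; rewrite mem_cat xv ?orbT.
Qed.

Hypothesis char0 : [pchar k] =i pred0.

Lemma poly_alg_eq0 (R : comAlgType k) (q : {poly R}) :
  (forall c : k, q.[c%:A] = 0) -> q = 0.
Proof.
move=> q0; apply/polyP => i; rewrite coef0.
have [/(nth_default 0)//|lt_i] := leqP (size q) i.
apply: (@vect_poly_eq0 _ char0 R (size q) (fun i => q`_i)) => // t.
rewrite -[RHS](q0 t) horner_coef; apply: eq_bigr => j _.
by rewrite exprZn expr1n -scalerAr mulr1.
Qed.

(** The field k is infinite, and the variables can move from k to R one at a time, each move
    concerning a polynomial in one variable. *)
Lemma jeval_transfer p : (forall v, jeval (R := k) id v p = 0) ->
  forall (R : comAlgType k) v, jeval (R := R) (in_alg R) v p = 0.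
Proof.
move=> p0 R v0.
(* The variables in s take values in R, the other ones in k. *)
suff hyb (s : seq (option (I * nat))) (v : _ -> R) :
    (forall x, x \notin s -> exists c : k, v x = c%:A) ->
    jeval (in_alg R) v p = 0.
  pose v x := if x \in jvars p then v0 x else 0.
  rewrite (@eq_jeval _ _ (in_alg R) _ v) // => [|x xp]; last by rewrite /v xp.
  by apply: (hyb (jvars p)) => x /negPf; rewrite /v => ->; exists 0; rewrite scale0r.
elim: s v => [|x s IH] v hv.
  have /choice [c cE] : forall x, exists c : k, v x = c%:A by move=> x; apply: hv.
  rewrite (@eq_jeval _ _ (in_alg R \o id) _ (in_alg R \o c)) //.
  by rewrite -jeval_rmorph p0 rmorph0.
pose vx (r : R) y := if y == x then r else v y.
pose q := jeval (R := {poly R}) (polyC \o in_alg R)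
  (fun y => if y == x then 'X else (v y)%:P) p.
have qE r : q.[r] = jeval (in_alg R) (vx r) p.
  rewrite -[LHS]/(horner_eval r q) jeval_rmorph; apply: eq_jeval => [c|y _] /=.
    by rewrite /horner_eval hornerC.
  by rewrite /vx /horner_eval; case: eqP => _; rewrite (hornerX, hornerC).
have q0 : q = 0.
  apply: poly_alg_eq0 => c; rewrite qE; apply: IH => y ys; rewrite /vx.
  case: eqP => [_|/eqP yx]; first by exists c.
  by apply: hv; rewrite inE negb_or yx.
have := qE (v x); rewrite q0 horner0 => ->; apply: eq_jeval => // y _.
by rewrite /vx; case: eqP => // ->.
Qed.

(* jterm t = (p, n), where p represents c^n t, c being the value at None. *)
Fixpoint jterm (t : lie_term k I) : jexp * nat :=
  match t with
  | LVar i => (JVar i 0, 0)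
  | LZero => (JZero, 0)
  | LAdd s t =>
      let: (p, m) := jterm s in let: (q, n) := jterm t in
      (JAdd (iter n JMulc p) (iter m JMulc q), m + n)
  | LScale c t => let: (p, m) := jterm t in (JScale c p, m)
  | LBr s t =>
      let: (p, m) := jterm s in let: (q, n) := jterm t in
      (JAdd (JMul p (jder q)) (JOpp (JMul (jder p) q)), (m + n).+1)
  end%N.

Section Eval.
Variables (R : comAlgType k) (L : lieAlgType k) (lam : {linear L -> R}) (e : L).
Hypothesis lam_rel : forall x y,
  lam e * lam (lbr x y) = lam x * lam (lbr e y) - lam (lbr e x) * lam y.
Variable l : I -> L.

Let v (x : option (I * nat)) : R :=
  if x is Some (i, j) then lam (iter j (lbr e) (l i)) else lam e.
Let E m p := jeval (in_alg R) v (iter m jder p).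
(** All derivatives are included so that the induction passes through [LBr], where [jder] occurs. *)
Let represents p n x := forall m, E m p = lam e ^+ n * lam (iter m (lbr e) x).

Let E_add m p q : E m (JAdd p q) = E m p + E m q.
Proof. by rewrite /E; elim: m p q => // m IH p q; rewrite !iterSr IH. Qed.

Let E_opp m p : E m (JOpp p) = - E m p.
Proof. by rewrite /E; elim: m p => // m IH p; rewrite !iterSr IH. Qed.

Let E_scale m c p : E m (JScale c p) = c *: E m p.
Proof.
rewrite /E; elim: m p => [|m IH] p; last by rewrite !iterSr IH.
by rewrite /= -scalerAl mul1r.
Qed.

Let E_mulc m n p : E m (iter n JMulc p) = lam e ^+ n * E m p.
Proof.
elim: n => [|n IH]; first by rewrite mul1r.
rewrite exprS -mulrA -IH /= /E {IH}; elim: m (iter n _ _) => // m IHm q.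
by rewrite !iterSr IHm.
Qed.

Let iter_lbrS m x y : iter m.+1 (lbr e) (lbr x y) =
  iter m (lbr e) (lbr (lbr e x) y) + iter m (lbr e) (lbr x (lbr e y)).
Proof.
rewrite iterSr; have -> : lbr e (lbr x y) = lbr (lbr e x) y + lbr x (lbr e y).
  by lie [:: y].
by elim: m => //= m ->; rewrite lbrDr.
Qed.

(** Order zero is [lam_rel], which costs one more factor [lam e]. Higher orders follow by the
    Leibniz rule for both [jder] and [lbr e]. *)
Let represents_br p m x q n y : represents p m x -> represents q n y ->
  represents (JAdd (JMul p (jder q)) (JOpp (JMul (jder p) q))) (m + n).+1
    (lbr x y).
Proof.
have represents_der p' m' x' :
    represents p' m' x' -> represents (jder p') m' (lbr e x').
  by move=> h i; have := h i.+1; rewrite /E !iterSr.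
move=> hp hq i; elim: i p x q y hp hq => [|i IH] p x q y hp hq.
  have := hp 0%N; have := hq 0%N; have := hp 1%N; have := hq 1%N.
  rewrite /E /= => -> -> -> ->; rewrite exprSr -mulrA lam_rel exprD.
  ring.
rewrite iter_lbrS linearD mulrDr.
rewrite -(IH (jder p) (lbr e x) q y) //; last exact: represents_der.
rewrite -(IH p x (jder q) (lbr e y)) //; last exact: represents_der.
have ES r : E i.+1 r = E i (jder r) by rewrite /E iterSr.
rewrite ES /= !(E_add, E_opp); ring.
Qed.

Lemma jterm_eval t :
  jeval (in_alg R) v (jterm t).1 = lam e ^+ (jterm t).2 * lam (lie_term_eval l t).
Proof.
suff : represents (jterm t).1 (jterm t).2 (lie_term_eval l t) by move/(_ 0%N).
elim: t => [i||s IHs t IHt|c t IHt|s IHs t IHt] /=.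
- move=> m; rewrite /E mul1r; suff -> : iter m jder (JVar i 0) = JVar i m by [].
  by elim: m => //= m ->.
- move=> m; rewrite /E; have -> : iter m jder JZero = JZero by elim: m => //= m ->.
  have -> : iter m (lbr e) 0 = 0 by elim: m => //= m ->; rewrite lbr0r.
  by rewrite linear0 mulr0.
- case: (jterm s) IHs => p m IHs; case: (jterm t) IHt => q n IHt i /=.
  have -> : iter i (lbr e) (lie_term_eval l s + lie_term_eval l t) =
      iter i (lbr e) (lie_term_eval l s) + iter i (lbr e) (lie_term_eval l t).
    by elim: i => //= i ->; rewrite lbrDr.
  rewrite E_add !E_mulc IHs IHt linearD exprD /=; ring.
- case: (jterm t) IHt => q n IHt i /=.
  have -> : iter i (lbr e) (c *: lie_term_eval l t) =
      c *: iter i (lbr e) (lie_term_eval l t).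
    by elim: i => //= i ->; rewrite lbrZr.
  by rewrite E_scale IHt linearZ /= scalerAr.
- case: (jterm s) IHs => p m IHs; case: (jterm t) IHt => q n IHt /=.
  exact: represents_br.
Qed.
End Eval.
End JetExpressions.

(** * Realization by power series and transfer to commutative algebras *)

Section Realization.
Variables (k : fieldType) (char0 : [pchar k] =i pred0) (I : eqType).
Variable f : free_lie k I.
Hypothesis f_identity : forall w : I -> W1tilde k, lie_subst w f = 0.

Section PowerSeries.
Variables (a : k) (a_neq0 : a != 0).

(** Evaluation at the origin, scaled so that [lam one] is the prescribed constant [a]. *)
Let lam (w : W1tilde k) : k^o := a * (w : fps k) 0%N.

Let lam_linear : linear lam.
Proof. by move=> c u v; rewrite /lam -[LHS]/(a * (c * _ + _)) mulrDr mulrCA. Qed.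

HB.instance Definition _ := GRing.isLinear.Build k (W1tilde k) k^o *:%R lam lam_linear.

Let one : W1tilde k := fps_one k.

Let lbr_one (w : W1tilde k) : lbr one w = fps_der (w : fps k).
Proof.
rewrite -[LHS]/((1 : fps k) * fps_der w - fps_der 1 * (w : fps k)) mul1r.
suff -> : fps_der (1 : fps k) = 0 by rewrite mul0r subr0.
by apply/funext => n; rewrite /fps_der -[(1 : fps k) n.+1]/(0 : k) mul0rn.
Qed.

Let iter_lbr_one j (w : W1tilde k) m :
  (iter j (lbr one) w : fps k) m = (w : fps k) (m + j)%N *+ (m + j) ^_ j.
Proof.
elim: j m => [|j IH] m; first by rewrite addn0 ffactn0.
rewrite [iter _ _ _]/= lbr_one /fps_der IH addSnnS -mulrnA.
by rewrite ffactnSr addnS subSn ?leq_addl // addnK.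
Qed.

Let fps_mul0 (g h : fps k) : (g * h) 0%N = g 0%N * h 0%N.
Proof. by rewrite -[LHS]/(\sum_(i < 1) _) big_ord1. Qed.

Let lam_rel x y : lam one * lam (lbr x y) =
  lam x * lam (lbr one y) - lam (lbr one x) * lam y :> k^o.
Proof.
rewrite !lbr_one /lam.
rewrite -[lbr x y]/((x : fps k) * fps_der y - fps_der x * (y : fps k)).
rewrite -[(_ - _) 0%N]/((_ : fps k) 0%N - (_ : fps k) 0%N) !fps_mul0.
rewrite -[one 0%N]/(1 : k).
ring.
Qed.

Lemma jterm_vanish_neq0 v : v None = a ->
  jeval (R := k) id v (jterm (repr f)).1 = 0.
Proof.
move=> va.
(* The Taylor coefficients are chosen so that [lam] maps the j-th derivative of [w i] to the value
   of [v] at (i, j). *)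
pose w (i : I) : W1tilde k := (fun j => v (Some (i, j)) / (a * j`!%:R)) : fps k.
have := @jterm_eval k I k^o (W1tilde k) lam one lam_rel w (repr f).
rewrite -/(lie_subst w f) f_identity linear0 mulr0 => h.
rewrite -[RHS]h; apply: eq_jeval => [c|[[i j]|] _] /=; first exact/esym/mulr1.
  rewrite /lam iter_lbr_one add0n ffactnn /w.
  have /negPf jn0 : j`!%:R != 0 :> k by rewrite natf_char0_eq0 // -lt0n fact_gt0.
  by rewrite -mulr_natr; field; rewrite jn0 a_neq0.
by rewrite /lam -[one 0%N]/(1 : k) mulr1.
Qed.
End PowerSeries.

Lemma realization (R : comAlgType k) (L : lieAlgType k) (lam : {linear L -> R}) e
    (l : I -> L) :
  (forall x y,
     lam e * lam (lbr x y) = lam x * lam (lbr e y) - lam (lbr e x) * lam y) ->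
  lam e ^+ (jterm (repr f)).2.+1 * lam (lie_subst l f) = 0.
Proof.
move=> lam_rel; rewrite exprS -mulrA /lie_subst -jterm_eval //.
rewrite -[LHS]/(jeval (in_alg R) _ (JMulc (jterm (repr f)).1)).
apply: jeval_transfer => // v /=.
have [->|v0] := eqVneq (v None) 0; first by rewrite mul0r.
by rewrite (jterm_vanish_neq0 v0) // mulr0.
Qed.
End Realization.

(* The commutative algebra generated by commuting operators is replaced by
   their bicommutant. *)
Section Bicommutant.
Variables (k : fieldType) (V : lmodType k) (T : Type) (F : T -> {linear V -> V}).

Definition in_bicommutant (g : V -> V) : Prop :=
  linear g /\ forall h : {linear V -> V},
    (forall t u, h (F t u) = F t (h u)) -> forall u, h (g u) = g (h u).

(** Both hypotheses are parameters of the type, so that its structure of nonzero commutative ring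
    can be inferred from it. *)
Definition bicommutant (V_neq0 : exists u : V, u != 0)
    (F_comm : forall s t u, F s (F t u) = F t (F s u)) : Type :=
  {g : V -> V | in_bicommutant g}.

Variables (V_neq0 : exists u : V, u != 0).
Variable F_comm : forall s t u, F s (F t u) = F t (F s u).
Local Notation C := (bicommutant V_neq0 F_comm).
Implicit Types g h : C.

HB.instance Definition _ := gen_eqMixin C.
HB.instance Definition _ := gen_choiceMixin C.

(* Locked, as the action of a sum would otherwise unify with a sum. *)
Definition bc_act (g : C) : V -> V := locked (sval g).

Lemma bc_actE g u : bc_act g u = sval g u.
Proof. by rewrite /bc_act -lock. Qed.

Fact bc_act_linear g : linear (bc_act g).
Proof. by move=> a u v; rewrite !bc_actE; apply: (svalP g).1. Qed.
HB.instance Definition _ g :=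
  GRing.isLinear.Build k V V *:%R (bc_act g) (bc_act_linear g).

Lemma bc_ext g h : bc_act g =1 bc_act h -> g = h.
Proof.
move=> gh; have {gh} : sval g =1 sval h by move=> u; rewrite -!bc_actE.
by case: g h => g gP [h hP] /= gh; apply/eq_exist/funext.
Qed.

Lemma bc_act_comm g (h : {linear V -> V}) :
  (forall t u, h (F t u) = F t (h u)) -> forall u, h (bc_act g u) = bc_act g (h u).
Proof. by move=> hc u; rewrite !bc_actE; apply: (svalP g).2. Qed.

(** The [F t] commute, so the bicommutant is contained in the commutant. *)
Lemma bc_actC g h u : bc_act g (bc_act h u) = bc_act h (bc_act g u).
Proof.
apply: bc_act_comm => t v; apply/esym.
by apply: bc_act_comm => s; apply: F_comm.
Qed.

Fact bc_zero_subproof : in_bicommutant (fun=> 0).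
Proof. by split=> [a u v|h _ u]; rewrite ?scaler0 ?addr0 ?linear0. Qed.
Fact bc_one_subproof : in_bicommutant id.
Proof. by []. Qed.
Fact bc_add_subproof g h : in_bicommutant (fun u => bc_act g u + bc_act h u).
Proof.
split=> [a u v|l lc u]; first by rewrite !bc_act_linear scalerDr addrACA.
by rewrite linearD (bc_act_comm g lc) (bc_act_comm h lc).
Qed.
Fact bc_scale_subproof a g : in_bicommutant (fun u => a *: bc_act g u).
Proof.
split=> [b u v|l lc u]; first by rewrite bc_act_linear scalerDr !scalerA mulrC.
by rewrite linearZ /= (bc_act_comm g lc).
Qed.
Fact bc_mul_subproof g h : in_bicommutant (fun u => bc_act g (bc_act h u)).
Proof.
split=> [b u v|l lc u]; first by rewrite !bc_act_linear.
by rewrite (bc_act_comm g lc) (bc_act_comm h lc).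
Qed.

Definition bc_zero : C := exist _ _ bc_zero_subproof.
Definition bc_one : C := exist _ _ bc_one_subproof.
Definition bc_add g h : C := exist _ _ (bc_add_subproof g h).
Definition bc_scale a g : C := exist _ _ (bc_scale_subproof a g).
Definition bc_opp g : C := bc_scale (-1) g.
Definition bc_mul g h : C := exist _ _ (bc_mul_subproof g h).

Let addE g h u : bc_act (bc_add g h) u = bc_act g u + bc_act h u.
Proof. by rewrite [LHS]bc_actE. Qed.
Let scaleE a g u : bc_act (bc_scale a g) u = a *: bc_act g u.
Proof. by rewrite [LHS]bc_actE. Qed.
Let mulE g h u : bc_act (bc_mul g h) u = bc_act g (bc_act h u).
Proof. by rewrite [LHS]bc_actE. Qed.
Let zeroE u : bc_act bc_zero u = 0. Proof. by rewrite bc_actE. Qed.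
Let oneE u : bc_act bc_one u = u. Proof. by rewrite bc_actE. Qed.

Fact bc_addA : associative bc_add.
Proof. by move=> g h l; apply: bc_ext => u; rewrite !addE addrA. Qed.
Fact bc_addC : commutative bc_add.
Proof. by move=> g h; apply: bc_ext => u; rewrite !addE addrC. Qed.
Fact bc_add0 : left_id bc_zero bc_add.
Proof. by move=> g; apply: bc_ext => u; rewrite addE zeroE add0r. Qed.
Fact bc_addN : left_inverse bc_zero bc_opp bc_add.
Proof. by move=> g; apply: bc_ext => u; rewrite addE scaleE zeroE scaleN1r addNr. Qed.

HB.instance Definition _ := GRing.isZmodule.Build C bc_addA bc_addC bc_add0 bc_addN.

Fact bc_mulA : associative bc_mul.
Proof. by move=> g h l; apply: bc_ext => u; rewrite !mulE. Qed.
Fact bc_mulC : commutative bc_mul.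
Proof. by move=> g h; apply: bc_ext => u; rewrite !mulE bc_actC. Qed.
Fact bc_mul1 : left_id bc_one bc_mul.
Proof. by move=> g; apply: bc_ext => u; rewrite mulE oneE. Qed.
Fact bc_mulDl : left_distributive bc_mul +%R.
Proof.
move=> g h l; apply: bc_ext => u.
by rewrite -[RHS]/(bc_act (bc_add _ _) u) !(mulE, addE).
Qed.
Fact bc_one_neq0 : bc_one != 0.
Proof.
apply/eqP => e; have [u /eqP] := V_neq0; apply.
by rewrite -[u]oneE e -[RHS](zeroE u).
Qed.

HB.instance Definition _ := GRing.Zmodule_isComNzRing.Build C
  bc_mulA bc_mulC bc_mul1 bc_mulDl bc_one_neq0.

Fact bc_scaleA a b g : bc_scale a (bc_scale b g) = bc_scale (a * b) g.
Proof. by apply: bc_ext => u; rewrite !scaleE scalerA. Qed.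
Fact bc_scale1 : left_id 1 bc_scale.
Proof. by move=> g; apply: bc_ext => u; rewrite scaleE scale1r. Qed.
Fact bc_scaleDr : right_distributive bc_scale +%R.
Proof.
move=> a g h; apply: bc_ext => u.
rewrite -[RHS]/(bc_act (bc_add _ _) u) -[g + h]/(bc_add g h).
by rewrite !(scaleE, addE) scalerDr.
Qed.
Fact bc_scaleDl g : {morph bc_scale^~ g : a b / a + b}.
Proof.
move=> a b; apply: bc_ext => u.
by rewrite -[RHS]/(bc_act (bc_add _ _) u) !(scaleE, addE) scalerDl.
Qed.

HB.instance Definition _ := GRing.Zmodule_isLmodule.Build k C
  bc_scaleA bc_scale1 bc_scaleDr bc_scaleDl.

Fact bc_scaleAl (a : k) g h : a *: (g * h) = (a *: g) * h.
Proof.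
apply: bc_ext => u; rewrite -[LHS]/(bc_act (bc_scale a (bc_mul g h)) u).
by rewrite -[RHS]/(bc_act (bc_mul (bc_scale a g) h) u) !(mulE, scaleE).
Qed.

HB.instance Definition _ := GRing.Lmodule_isLalgebra.Build k C bc_scaleAl.
HB.instance Definition _ := GRing.Lalgebra_isComAlgebra.Build k C.

Fact bc_gen_subproof t : in_bicommutant (F t).
Proof. by split=> [|h hc u]; [apply: linearP | apply: hc]. Qed.
Definition bc_gen t : C := exist _ _ (bc_gen_subproof t).

Lemma bc_act0 u : bc_act 0 u = 0. Proof. exact: zeroE. Qed.
Lemma bc_act1 u : bc_act 1 u = u. Proof. exact: oneE. Qed.
Lemma bc_actD g h u : bc_act (g + h) u = bc_act g u + bc_act h u.
Proof. exact: addE. Qed.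
Lemma bc_actZ a g u : bc_act (a *: g) u = a *: bc_act g u.
Proof. exact: scaleE. Qed.
Lemma bc_actN g u : bc_act (- g) u = - bc_act g u.
Proof. by rewrite -scaleN1r bc_actZ scaleN1r. Qed.
Lemma bc_actM g h u : bc_act (g * h) u = bc_act g (bc_act h u).
Proof. exact: mulE. Qed.
Lemma bc_act_gen t u : bc_act (bc_gen t) u = F t u.
Proof. by rewrite bc_actE. Qed.
Lemma bc_actX g n u : bc_act (g ^+ n) u = iter n (bc_act g) u.
Proof. by elim: n => [|n IH]; rewrite ?bc_act1 // exprS bc_actM IH. Qed.
End Bicommutant.

(** * Realization by commuting operators *)

Section OperatorRealization.
Variables (k : fieldType) (char0 : [pchar k] =i pred0) (I : eqType).
Variable f : free_lie k I.
Hypothesis f_identity : forall w : I -> W1tilde k, lie_subst w f = 0.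

Lemma operator_realization (V : lmodType k) (L : lieAlgType k)
    (lam : L -> {linear V -> V}) e (l : I -> L) :
  (forall u, linear (fun x => lam x u)) ->
  (forall x y u, lam x (lam y u) = lam y (lam x u)) ->
  (forall x y u, lam e (lam (lbr x y) u) =
     lam x (lam (lbr e y) u) - lam (lbr e x) (lam y u)) ->
  forall u, iter (jterm (repr f)).2.+1 (lam e) (lam (lie_subst l f) u) = 0.
Proof.
move=> lam_lin lam_comm lam_rel u.
have [u0|Vneq0] := pselect (forall v : V, v = 0); first exact: u0.
have {}Vneq0 : exists v : V, v != 0.
  apply: contrapT => h; apply: Vneq0 => v.
  by apply: contrapT => /eqP v0; apply: h; exists v.
pose C : comAlgType k := bicommutant Vneq0 lam_comm.
pose lamC (x : L) : C := bc_gen Vneq0 lam_comm x.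
have lamC_lin : linear lamC.
  by move=> a x y; apply: bc_ext => v; rewrite bc_actD bc_actZ !bc_act_gen lam_lin.
pose lamL : {linear L -> C} :=
  HB.pack lamC (GRing.isLinear.Build k L C *:%R lamC lamC_lin).
have rel x y :
    lamL e * lamL (lbr x y) = lamL x * lamL (lbr e y) - lamL (lbr e x) * lamL y.
  apply: bc_ext => v; rewrite bc_actD bc_actN !bc_actM !bc_act_gen; exact: lam_rel.
have := congr1 (fun g => bc_act g u) (realization char0 f_identity l rel).
by rewrite bc_actM bc_actX bc_act0 (eq_iter (bc_act_gen _ _ e)) bc_act_gen.
Qed.
End OperatorRealization.

(** * The part of type sl_2 *)

Section SL2Part.
Variables (k : fieldType) (char0 : [pchar k] =i pred0) (L : lieAlgType k).
Hypothesis LSt5 : standard_lie_identity5 L.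
Hypothesis Lsemiprime : lie_semiprime L.
Implicit Types (x y z u v e a b c d h : L).
Local Notation J := (@const_part k L).

Lemma identity_const_part (I : eqType) (f : free_lie k I) (l : I -> L) :
  (forall w : I -> W1tilde k, lie_subst w f = 0) -> J (lie_subst l f).
Proof.
move=> f_identity.
apply: (const_part_descent char0 Lsemiprime (n := (jterm (repr f)).2.+1)).
(* By symmetry the innermost factor [lder e w] at f(l) becomes lam(f(l)) applied to e. *)
move=> e w cw; rewrite iterSr (lder_sym _ _ cw.1).
apply: (@operator_realization _ char0 _ _ f_identity L L (fun x => lder x w) e l).
- move=> u t x y; rewrite !lderE !lbrDl !lbrZl linearD linearZ /=.
  by rewrite scalerBr opprD; apply: addrACA.
- by move=> x y u; apply: central_halfC; apply: lder_central.
- by move=> x y u; apply: lder_realize.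
Qed.

Hypothesis L_neq0 : exists u : L, u != 0.

Let wron3 (t : L * L * L) : {linear L -> L} := wron t.1.1 t.1.2 t.2.
Let wron3C s t u : wron3 s (wron3 t u) = wron3 t (wron3 s u).
Proof. by apply: central_halfC; apply: central_half_wron. Qed.

Local Notation C := (bicommutant L_neq0 wron3C).
Implicit Types (r s : C).
Local Notation "r • u" := (bc_act r u) (at level 35, right associativity).

(** The operator [wron a b c] as a scalar in the commutative ring [C]. *)
Definition om a b c : C := bc_gen L_neq0 wron3C (a, b, c).

Lemma omE a b c u : om a b c • u = wron a b c u.
Proof. exact: bc_act_gen. Qed.

Lemma om_cyc a b c : om a b c = om b c a.
Proof. by apply: bc_ext => u; rewrite !omE wron_cyc. Qed.

Lemma om_swap a b c : om a b c = - om b a c.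
Proof. by apply: bc_ext => u; rewrite bc_actN !omE wron_swap. Qed.

Lemma omaa a c : om a a c = 0.
Proof. by apply: bc_ext => u; rewrite omE wronxx bc_act0. Qed.

Lemma om_swapr a b c : om a b c = - om a c b.
Proof. by rewrite -om_cyc om_swap om_cyc. Qed.

Lemma omabb a b : om a b b = 0.
Proof. by rewrite om_cyc omaa. Qed.

Lemma omaba a b : om a b a = 0.
Proof. by rewrite om_swapr omaa oppr0. Qed.

Lemma omDl a a' b c : om (a + a') b c = om a b c + om a' b c.
Proof.
apply: bc_ext => u; rewrite bc_actD !omE /wron !lbrDr !lbrDl !lbrDr; zmod.
Qed.

Lemma omZl (q : k) a b c : om (q *: a) b c = q *: om a b c.
Proof.
apply: bc_ext => u; rewrite bc_actZ !omE /wron !(lbrZr, lbrZl, lbrDr, lbrDl).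
by rewrite !scalerDr.
Qed.

Lemma omNl a b c : om (- a) b c = - om a b c.
Proof.
apply: bc_ext => u; rewrite bc_actN !omE /wron !(lbrNr, lbrNl); zmod.
Qed.

Lemma omDr a b c c' : om a b (c + c') = om a b c + om a b c'.
Proof. by rewrite -!(om_cyc _ a b) omDl. Qed.

Lemma omNr a b c : om a b (- c) = - om a b c.
Proof. by rewrite -!(om_cyc _ a b) omNl. Qed.

Lemma omDm a b b' c : om a (b + b') c = om a b c + om a b' c.
Proof. by rewrite !(om_cyc a) omDl. Qed.

(** Cramer's rule: L behaves like a module of rank 3 with volume form [om]. *)
Lemma om4 a b c v : om a b c • v = om b c v • a + om c a v • b + om a b v • c.
Proof. by rewrite !omE -wron4. Qed.

(** Membership in the centroid of L. *)
Definition centroidal r := forall x u, r • lbr x u = lbr x (r • u).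

Lemma cen_lbrl r x u : centroidal r -> r • lbr x u = lbr (r • x) u.
Proof. by move=> cr; rewrite lbrC linearN /= cr -lbrC. Qed.

Lemma cenM r s : centroidal r -> centroidal s -> centroidal (r * s).
Proof. by move=> cr cs x u; rewrite !bc_actM cs cr. Qed.

Lemma cenX r n : centroidal r -> centroidal (r ^+ n).
Proof.
move=> cr; elim: n => [x u|n IH]; first by rewrite expr0 !bc_act1.
by rewrite exprS; apply: cenM.
Qed.

(** The image of [r] is an ideal, abelian because [r u, r v] = r^2 [u, v]. *)
Lemma cen_sqr_eq0 r : centroidal r -> r ^+ 2 = 0 -> r = 0.
Proof.
move=> cr r0; apply: bc_ext => u; rewrite bc_act0.
apply: (@abelian_ideal_eq0 _ _ Lsemiprime (fun v => exists u, v = r • u)).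
- apply/is_lie_idealP; split=> [|_ _ [v ->] [v' ->]|t _ [v ->]|x _ [v ->]].
  + by exists 0; rewrite linear0.
  + by exists (v + v'); rewrite linearD.
  + by exists (t *: v); rewrite linearZ.
  + by exists (lbr x v); rewrite cr.
- move=> _ _ [v ->] [v' ->]; rewrite -cr -cen_lbrl // -bc_actM -expr2 r0.
  exact: bc_act0.
- by exists u.
Qed.

Lemma cen_nilp_eq0 r n : centroidal r -> r ^+ n.+1 = 0 -> r = 0.
Proof.
move=> cr; elim: n => [|n IH]; first by rewrite expr1.
move=> r0; apply: IH; apply: cen_sqr_eq0; first exact: cenX.
by rewrite -exprM mulnS muln1 -addSnnS exprD r0 mul0r.
Qed.

Lemma om_const_part a b c u : J a -> J (om a b c • u).
Proof.
move=> Ja; rewrite omE /wron; apply: const_partD; first apply: const_partD.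
- by apply/const_partB/const_part_lbrl.
- by apply/const_part_lbrl/const_partB.
- exact/const_part_lbrl/const_part_lbrl.
Qed.

(** The commutator of ad x with [om a b c] takes values in J, so [const_part_lder] makes it zero. *)
Lemma om_cen a b c : J a -> centroidal (om a b c).
Proof.
move=> Ja x u; have cw := central_half_wron char0 LSt5 a b c.
suff : lder x (wron a b c) u = 0.
  by rewrite lderE !omE => /eqP; rewrite subr_eq0 => /eqP ->.
apply: (const_part_lder Lsemiprime cw).
rewrite lderE /= -!omE; apply: const_partD; first exact/const_partB/om_const_part.
exact/const_partN/om_const_part.
Qed.

Lemma om_cen2 a b c : J b -> centroidal (om a b c).
Proof. by rewrite om_cyc; apply: om_cen. Qed.

Lemma om_cen3 a b c : J c -> centroidal (om a b c).
Proof. by rewrite -om_cyc; apply: om_cen. Qed.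

Ltac om_cen_tac := do ?[exact: om_cen | exact: om_cen2 | exact: om_cen3].

Lemma om_cenl r a b c : centroidal r -> om (r • a) b c = r * om a b c.
Proof.
move=> cr; apply: bc_ext => u; rewrite bc_actM !omE /wron.
rewrite 2!linearD /= (cr (lbr b c)) (cen_lbrl a u cr) (cen_lbrl (lbr c a) _ cr).
by rewrite (cr c a) (cen_lbrl (lbr a b) _ cr) (cen_lbrl a b cr).
Qed.

Lemma om_cenr r a b c : centroidal r -> om a b (r • c) = r * om a b c.
Proof. by move=> cr; rewrite -om_cyc om_cenl // om_cyc. Qed.

(** By the Leibniz rule [lbr_wron] this sum is the commutator of ad x with [om a b c]. *)
Lemma om_inv x a b c : centroidal (om a b c) ->
  om (lbr x a) b c + om a (lbr x b) c + om a b (lbr x c) = 0.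
Proof.
move=> cabc; apply: bc_ext => u; rewrite !bc_actD bc_act0.
have := lbr_wron x a b c u; rewrite -!omE -cabc.
by rewrite -[X in X = _ -> _]add0r => /addIr <-.
Qed.

Lemma double_eq0 r : r + r = 0 -> r = 0.
Proof.
rewrite -mulr2n -scaler_nat => /eqP; rewrite scaler_eq0 natf_char0_eq0 //.
by move=> /eqP.
Qed.

(** The first Bianchi identity for the curvature tensor om a b [c, d]. *)
Lemma om_bianchi x a b c : centroidal (om a b c) ->
  om (lbr x a) b c + om (lbr x b) c a + om (lbr x c) a b = 0.
Proof.
move=> /(om_inv x) <-; rewrite -(om_cyc (lbr x c)) -(om_cyc a).
by rewrite (om_cyc a (lbr x b)).
Qed.

(* The symmetry of the Riemann curvature tensor, for om a b (lbr c d). *)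
Lemma om_curv_sym a b c d :
  centroidal (om a b c) -> centroidal (om b c d) ->
  centroidal (om c d a) -> centroidal (om d a b) ->
  om a b (lbr c d) = om c d (lbr a b).
Proof.
move=> /(om_bianchi d) B1 /(om_bianchi a) B2 /(om_bianchi b) B3 /(om_bianchi c) B4.
rewrite -!(om_cyc (lbr _ _)).
apply/eqP; rewrite -subr_eq0; apply/eqP/double_eq0.
have := congr2 (fun p q => q - p) (congr2 +%R B1 B2) (congr2 +%R B3 B4).
rewrite !addr0 subrr => <-.
rewrite (lbrC d a) (lbrC d b) (lbrC d c) (lbrC b a) (lbrC c a) (lbrC c b) !omNl.
rewrite (om_swapr _ c a) (om_swapr _ b d).
ring.
Qed.

Lemma om0l b c : om 0 b c = 0.
Proof. by apply: (addrI (om 0 b c)); rewrite -omDl !addr0. Qed.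

Lemma om0r a b : om a b 0 = 0.
Proof. by rewrite -om_cyc om0l. Qed.

(* The kernel of [x |-> om x h n] is a subalgebra when [n] is an eigenvector of
   [ad h]; here is the polarized form of this fact, where [n] varies. *)
Lemma om_functional h n n' x y z : J h -> J n -> J n' ->
  om x h n * om (lbr y z) h n' - om y h n * om (lbr x z) h n'
    + om z h n * om (lbr x y) h n' =
  om y x h * (om z (lbr h n) n' - om z h (lbr n n'))
    + om n y x * om z h (lbr h n') - om z h n * om (lbr h n') y x.
Proof.
move=> Jh Jn Jn'.
(* Cramer's rule for x, y, h, n; bracketing with z and applying [om] with h, n' yields [e2]. *)
have e1 : om x h n • y - om y h n • x = om y x h • n - om n y x • h.
  rewrite om4 (om_cyc h n y) (om_cyc n y h) (om_swapr n x y) bc_actN (om_cyc y x h).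
  rewrite (om_cyc n y x). zmod.
have e2 : om x h n * om (lbr y z) h n' - om y h n * om (lbr x z) h n' =
          om y x h * om (lbr n z) h n' - om n y x * om (lbr h z) h n'.
  have := congr1 (fun v => om (lbr v z) h n') e1.
  rewrite !lbrDl !lbrNl !omDl !omNl.
  by rewrite -!cen_lbrl ?om_cenl //; om_cen_tac.
have e3 : om (lbr h z) h n' = - om z h (lbr h n').
  have /(om_inv h) : centroidal (om z h n') by apply: om_cen2.
  rewrite lbrxx (om_cyc z 0) om0l addr0 => /eqP.
  by rewrite addr_eq0 => /eqP.
have e4 : om (lbr n z) h n' = om z (lbr h n) n' - om z h (lbr n n').
  have /(om_inv n) : centroidal (om z h n') by apply: om_cen2.
  rewrite (lbrC n h) (om_cyc z (- _)) omNl -(om_cyc z (lbr h n)) => /eqP.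
  by rewrite -addrA addr_eq0 opprD opprK => /eqP.
have e5 : om (lbr x y) h n' = - om (lbr h n') y x.
  rewrite om_cyc om_curv_sym; om_cen_tac.
  by rewrite om_swap -om_cyc.
rewrite e2 e3 e4 e5; ring.
Qed.

(** * Pairs h, y in J and the eigenvector of ad h *)

Section Pair.
Variables (h y : L) (Jh : J h) (Jy : J y).
Let c := lbr h y.
Let w := om h y c.
Let A := om y c (lbr h c).
Let B := om h c (lbr h c).
Let E := om y c (lbr y c).

Let Jc : J c. Proof. exact: const_partB. Qed.
Let cw : centroidal w. Proof. exact: om_cen. Qed.
Let cA : centroidal A. Proof. exact: om_cen. Qed.
Let cB : centroidal B. Proof. exact: om_cen. Qed.
Let cE : centroidal E. Proof. exact: om_cen. Qed.

(** Cramer's rule in terms of h, y, c; the coefficient of c vanishes by [om_inv]. *)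
Lemma pair_lbrh : w • lbr h c = A • h - B • y.
Proof.
rewrite om4 (om_swap c h) bc_actN.
have /(om_inv h) : centroidal w by [].
by rewrite lbrxx om0l -/c omabb !add0r => ->; rewrite bc_act0 addr0.
Qed.

Lemma pair_lbry : w • lbr y c = E • h - A • y.
Proof.
rewrite om4 (om_swap c h) bc_actN.
rewrite (@om_curv_sym h c y c); om_cen_tac.
have /(om_inv y) : centroidal w by [].
rewrite lbrxx (lbrC y h) omNl -/c omaba (om_cyc h) om0l oppr0 !add0r => ->.
by rewrite bc_act0 addr0.
Qed.

Variables (I : eqType) (f : free_lie k I) (l : I -> L).
Hypothesis f_identity : forall w : I -> W1tilde k, lie_subst w f = 0.
Let z := lie_subst l f.

(** With s a square root of - w B, the vector n = n0 + s c satisfies w [h, n] = s n; [a] and [b]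
    below are the components of lam(x) = om x h n. *)
Let n0 := w • lbr h c.
Let Jn0 : J n0. Proof. exact: om_const_part. Qed.
Let a x := om x h n0.
Let b x := om x h c.

Let lbr_h_n0 : lbr h n0 = - (B • c).
Proof.
by rewrite /n0 pair_lbrh lbrDr lbrNr -cA -cB lbrxx linear0 add0r.
Qed.

Let n0_om u v : om n0 u v = w * om (lbr h c) u v.
Proof. exact: om_cenl. Qed.

(** The component without s of the subalgebra relation for lam = a + s b, from [om_functional] at
    (n0, n0) and (c, c). The mixed pairs give the component in s, [om_rel_im]. *)
Let om_rel_re x y' z' :
  a x * a (lbr y' z') - w * B * (b x * b (lbr y' z')) =
  a y' * a (lbr x z') - w * B * (b y' * b (lbr x z'))
   - (a (lbr x y') * a z' - w * B * (b (lbr x y') * b z')).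
Proof.
have := om_functional x y' z' Jh Jn0 Jn0; have := om_functional x y' z' Jh Jc Jc.
rewrite !lbrxx !om0r lbr_h_n0.
rewrite (om_cyc z' (- _)) !omNl omNr (om_cenl c _ _ cB) (om_cenl c _ _ cB).
rewrite (om_cenr _ _ c cB) (om_cyc c n0) (om_cyc z' (lbr h c) c).
rewrite (om_swapr (lbr h c) c z') /a /b -!(om_cyc n0 _ h) !n0_om.
rewrite -!(om_cyc (lbr h c) _ h) => e1 e2.
apply/eqP; rewrite -subr_eq0; apply/eqP.
have := congr2 (fun p q => p - w * B * q) e2 e1.
move/eqP; rewrite -subr_eq0 => /eqP <-.
ring.
Qed.

Let om_rel_im x y' z' :
  a x * b (lbr y' z') + b x * a (lbr y' z') =
  a y' * b (lbr x z') + b y' * a (lbr x z')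
   - (a (lbr x y') * b z' + b (lbr x y') * a z').
Proof.
have := om_functional x y' z' Jh Jn0 Jc; have := om_functional x y' z' Jh Jc Jn0.
rewrite !lbr_h_n0 (lbrC n0 c) !omNr !omNl (om_cyc z' (- _)) omNl.
rewrite (om_cenl c _ _ cB) (om_cenl c _ _ cB) (om_cenr _ _ c cB) omaa.
rewrite -(om_cyc n0 z' (lbr h c)) /a /b -!(om_cyc n0 _ h) !n0_om omaba => e1 e2.
rewrite -!(om_cyc (lbr h c) _ h) in e1 e2.
apply/eqP; rewrite -subr_eq0; apply/eqP.
have := congr2 +%R e2 e1; move/eqP; rewrite -subr_eq0 => /eqP <-.
ring.
Qed.

Let a_lin : linear a.
Proof.
by move=> t u v; rewrite /a omDl omZl.
Qed.
Let b_lin : linear b.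
Proof. by move=> t u v; rewrite /b omDl omZl. Qed.

(* The action of [r + s sqrt (- w B)] on [L + L sqrt (- w B)]. *)
Let qmul r s (p : L * L) : L * L :=
  (r • p.1 - (w * B * s) • p.2, r • p.2 + s • p.1).

Let qmul_linear r s : linear (qmul r s).
Proof.
move=> q p p'; congr (_, _); rewrite /= !bc_act_linear.
  by rewrite opprD scalerBr addrACA.
by rewrite scalerDr addrACA.
Qed.

Let qmulM r s r' s' p :
  qmul r s (qmul r' s' p) = qmul (r * r' - w * B * (s * s')) (r * s' + s * r') p.
Proof.
congr (_, _); rewrite /= !linearB !linearD /= -!bc_actM.
rewrite mulrDr !bc_actD !bc_actN.
  have -> : r * (w * B * s') = w * B * (r * s') by ring.
  rewrite !mulrA; zmod.
rewrite !bc_actD !bc_actN.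
have -> : s * (w * B * s') = w * B * (s * s') by ring.
rewrite !mulrA; zmod.
Qed.

Let qmulB r s r' s' p : qmul r s p - qmul r' s' p = qmul (r - r') (s - s') p.
Proof.
congr (_, _); rewrite /= ?mulrBr !bc_actD !bc_actN; zmod.
Qed.

Let lam x : {linear (L * L)%type -> (L * L)%type} :=
  HB.pack (qmul (a x) (b x))
    (GRing.isLinear.Build k (L * L)%type (L * L)%type *:%R
       (qmul (a x) (b x)) (qmul_linear (a x) (b x))).

(** The realization principle is applied with e = z = f(l) itself. *)
Let lam_nilp : exists m, forall u : (L * L)%type, iter m.+1 (lam z) u = 0.
Proof.
exists (jterm (repr f)).2.+1 => u; rewrite iterSr.
apply: (@operator_realization _ char0 _ _ f_identity _ L lam z l).
- move=> p q x x'.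
  rewrite -[LHS]/(qmul (a (q *: x + x')) (b (q *: x + x')) p).
  rewrite -[RHS]/(q *: qmul (a x) (b x) p + qmul (a x') (b x') p).
  rewrite /qmul a_lin b_lin.
  congr (_, _); rewrite /= ?mulrDr !bc_actD -?scalerAr !bc_actZ.
    by rewrite opprD scalerBr addrACA.
  by rewrite scalerDr addrACA.
- by move=> x x' p; rewrite /lam /= !qmulM; congr (qmul _ _ p); ring.
- move=> x x' p; rewrite /lam /= !qmulM qmulB om_rel_re om_rel_im.
  by congr (qmul _ _ p); ring.
Qed.

(* p is the sequence of powers of r + s sqrt (- d). *)
Lemma quadratic_nilp (R : comNzRingType) (d r s : R) (p : nat -> R * R) :
  p 0%N = (1, 0) ->
  (forall m, p m.+1 = (r * (p m).1 - d * s * (p m).2, r * (p m).2 + s * (p m).1)) ->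
  (forall m, (p m).1 ^+ 2 + d * (p m).2 ^+ 2 = (r ^+ 2 + d * s ^+ 2) ^+ m) /\
  (r ^+ 2 + d * s ^+ 2 = 0 -> forall m,
     p m.+1 = (2 ^+ m * r ^+ m.+1, 2 ^+ m * r ^+ m * s)).
Proof.
move=> p0 pS; split=> [|e].
  elim=> [|m IH]; first by rewrite p0 /=; ring.
  rewrite pS [RHS]exprS -IH /=; ring.
elim=> [|m IH]; first by rewrite pS p0 /=; congr (_, _); ring.
have e' : d * s * s = - r * r by rewrite -[RHS]addr0 -e; ring.
rewrite pS IH /= !exprS; move: (2 ^+ m) (r ^+ m) => q t; congr (_, _); last by ring.
have -> : d * s * (q * t * s) = (d * s * s) * (q * t) by ring.
rewrite e'; ring.
Qed.

(** Nilpotency of a z + s b z passes to its norm, which is centroidal and hence zero. Then the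
    powers of a z + s b z are its multiples by powers of 2 a z, so [a z] is nilpotent. *)
Let a_z_eq0 : a z = 0.
Proof.
have [M hM] := lam_nilp.
pose p := fix p m : C * C := if m is n.+1 then
  (a z * (p n).1 - w * B * b z * (p n).2, a z * (p n).2 + b z * (p n).1) else (1, 0).
have pE m u : iter m (lam z) (u, 0) = ((p m).1 • u, (p m).2 • u).
  elim: m => [|m IH]; first by rewrite /= bc_act1 bc_act0.
  rewrite iterS IH -[LHS]/(qmul (a z) (b z) _).
  by congr (_, _); rewrite /= bc_actD ?bc_actN !(bc_actM _ _ u).
have pM : p M.+1 = (0, 0).
  have pu u : ((p M.+1).1 • u, (p M.+1).2 • u) = 0.
    exact: etrans (esym (pE M.+1 u)) (hM (u, 0)).
  rewrite [LHS]surjective_pairing; congr (_, _); apply: bc_ext => u; rewrite bc_act0.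
    exact: (congr1 fst (pu u)).
  exact: (congr1 snd (pu u)).
have ca : centroidal (a z) by apply: om_cen2.
have cb : centroidal (b z) by apply: om_cen2.
have [h1 h2] := @quadratic_nilp C (w * B) (a z) (b z) p erefl (fun=> erefl).
have norm0 : a z ^+ 2 + w * B * b z ^+ 2 = 0.
  apply: (@cen_nilp_eq0 _ M); last by rewrite -h1 pM /= expr0n mulr0 addr0.
  move=> x u; rewrite !bc_actD (cenX 2 ca) lbrDr; congr (_ + _).
  by apply: (cenM (cenM cw cB)); apply: cenX.
have := congr1 fst (h2 norm0 M); rewrite pM /= => /esym.
move=> a0; apply: (@cen_nilp_eq0 _ M) => //.
apply/eqP; move/eqP: a0.
rewrite -natrX mulr_natl -scaler_nat scaler_eq0 natf_char0_eq0 //.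
by rewrite expn_eq0.
Qed.

(** Since n0 = A h - B y, the scalar [a z] is - B om z h y. *)
Lemma pair_B_eq0 : B * om z h y = 0.
Proof.
have : a z = 0 := a_z_eq0.
rewrite /a /n0 pair_lbrh omDr omNr (om_cenr _ _ _ cA) (om_cenr _ _ _ cB).
by rewrite omabb mulr0 add0r => /eqP; rewrite oppr_eq0 => /eqP.
Qed.

End Pair.

(** On the radical K all s_3 vanish, and 2 [[a, b], [c, d]] is a difference of two of them. So
    [K, K] lies in its centralizer [K3] in K, and even in the center [K4] of [K3]. Semiprimeness
    kills [K4], then the abelian ideal K. *)
Lemma om_radical_eq0 z : J z -> (forall h y, J h -> J y -> om z h y = 0) -> z = 0.
Proof.
move=> Jz z0.
pose K := [set z | J z /\ forall h y, J h -> J y -> om z h y = 0]%classic.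
have /is_lie_idealP [J0 _ JZ _] := @const_part_ideal k L.
have idK : is_lie_ideal K.
  apply/is_lie_idealP; split=> [|u v [Ju Ku] [Jv Kv]|q u [Ju Ku]|x u [Ju Ku]].
  - by split=> // h y _ _; apply: om0l.
  - by split=> [|h y Jh Jy]; [apply: const_partD | rewrite omDl Ku // Kv // addr0].
  - by split=> [|h y Jh Jy]; [apply: JZ | rewrite omZl Ku // scaler0].
  - split=> [|h y Jh Jy]; first exact: const_partB.
    have /(om_inv x) : centroidal (om u h y) by apply: om_cen.
    by rewrite (Ku (lbr x h)) ?(Ku h (lbr x y)) ?addr0 //; apply: const_partB.
have /is_lie_idealP [K0 KD KZ KB] := idK.
have metab a b c d : K a -> K b -> K c -> K d -> lbr (lbr a b) (lbr c d) = 0.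
  move=> Ka Kb Kc Kd; set P := lbr _ _.
  have wron0 p q q' u : K p -> K q -> K q' -> wron p q q' u = 0.
    by move=> [_ Kp] [Jq _] [Jr _]; rewrite -omE Kp // bc_act0.
  have e : P + P = wron a b c d - wron a b d c by rewrite /P /wron; lie [:: d].
  have /eqP : 2%:R *: P = 0 by rewrite scaler_nat mulr2n e !wron0 // subrr.
  by rewrite scaler_eq0 natf_char0_eq0 // => /eqP.
pose K3 := [set x | K x /\ forall u v, K u -> K v -> lbr x (lbr u v) = 0]%classic.
have idK3 : is_lie_ideal K3.
  apply/is_lie_idealP; split=> [|u v [Ku hu] [Kv hv]|q u [Ku hu]|x u [Ku hu]].
  - by split=> // u v _ _; rewrite lbr0l.
  - by split=> [|p q Kp Kq]; [apply: KD | rewrite lbrDl hu // hv // addr0].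
  - by split=> [|p p' Kp Kp']; [apply: KZ | rewrite lbrZl hu // scaler0].
  - split=> [|p q Kp Kq]; first exact: KB.
    have -> : lbr (lbr x u) (lbr p q) =
        lbr x (lbr u (lbr p q)) - (lbr u (lbr (lbr x p) q) + lbr u (lbr p (lbr x q))).
      by lie [:: q].
    by rewrite !hu ?lbr0r ?addr0 ?subr0 //; apply: KB.
have /is_lie_idealP [K30 K3D K3Z K3B] := idK3.
pose K4 := [set x | K3 x /\ forall u, K3 u -> lbr x u = 0]%classic.
have K4_eq0 x : K4 x -> x = 0.
  apply: (abelian_ideal_eq0 Lsemiprime) => [|u v [_ hu] [K3v _]]; last exact: hu.
  apply/is_lie_idealP; split=> [|u v [Ku hu] [Kv hv]|q u [Ku hu]|y u [Ku hu]].
  - by split=> // u _; rewrite lbr0l.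
  - by split=> [|p Kp]; [apply: K3D | rewrite lbrDl hu // hv // addr0].
  - by split=> [|p Kp]; [apply: K3Z | rewrite lbrZl hu // scaler0].
  - split=> [|p Kp]; first exact: K3B.
    by rewrite lbr_lbrl (hu p) // hu ?lbr0r ?subrr //; apply: K3B.
apply: (abelian_ideal_eq0 Lsemiprime idK) => // u v Ku Kv.
apply: K4_eq0; split=> [|x [Kx hx]]; last by rewrite lbrC hx ?oppr0.
by split=> [|p q Kp Kq]; [apply: KB | apply: metab].
Qed.

(** * Vanishing of om z on J *)

Section Vanishing.
Variables (z : L) (Jz : J z).
Hypothesis zB : forall h y, J h -> J y ->
  om h (lbr h y) (lbr h (lbr h y)) * om z h y = 0.

(** Replacing h by h + y and h - y turns B into B + 2 A + E and B - 2 A + E, so zeta kills A, B and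
    E. Hence zeta w kills [h, c] and [y, c], then zeta w^2 kills h, and zeta w^3 = 0. *)
Lemma pair_om_eq0 h y : J h -> J y -> om h y (lbr h y) * om z h y = 0.
Proof.
move=> Jh Jy; set c := lbr h y; have Jc : J c by apply: const_partB.
set w := om h y c; set zeta := om z h y.
pose A := om y c (lbr h c); pose B := om h c (lbr h c); pose E := om y c (lbr y c).
have hB : B * zeta = 0 by apply: zB.
have cz : centroidal zeta by apply: om_cen.
have cw : centroidal w by apply: om_cen.
have A' : om h c (lbr y c) = A.
  by apply: om_curv_sym; om_cen_tac.
have B1 : (B + A + A + E) * zeta = 0.
  have := zB (const_partD Jh Jy) Jy; rewrite !lbrDl lbrxx addr0 -/c.
  rewrite !(omDl, omDr, omDm) omabb addr0 A' -/A -/B -/E -/zeta => <-; ring.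
have B2 : (B - A - A + E) * zeta = 0.
  have := zB (const_partD Jh (const_partN Jy)) Jy.
  rewrite !(lbrDl, lbrNl) lbrxx subr0 -/c.
  rewrite !(omDl, omDr, omDm) !(omNl, omNr) (om_cyc z (- y)) omNl omaa oppr0.
  rewrite addr0 A' -/A -/B -/E -/zeta => <-; ring.
have hA : A * zeta = 0.
  apply/double_eq0/double_eq0.
  have -> : A * zeta + A * zeta + (A * zeta + A * zeta) =
            (B + A + A + E) * zeta - (B - A - A + E) * zeta by ring.
  by rewrite B1 B2 subrr.
have hE : E * zeta = 0.
  have -> : E * zeta = (B + A + A + E) * zeta - B * zeta - (A * zeta + A * zeta) by ring.
  by rewrite B1 hB hA addr0 !subr0.
have hc : (zeta * w) • lbr h c = 0.
  rewrite bc_actM pair_lbrh // linearB /= -!bc_actM -/c -/A -/B.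
  by rewrite !(mulrC zeta) hA hB !bc_act0 subrr.
have yc : (zeta * w) • lbr y c = 0.
  rewrite bc_actM pair_lbry // linearB /= -!bc_actM -/c -/A -/E.
  by rewrite !(mulrC zeta) hA hE !bc_act0 subrr.
have crw : centroidal (zeta * w) by apply: cenM.
have sq u : (zeta * w * w) • u = (zeta * w) • lbr c (lbr c u).
  rewrite (bc_actM _ w) omE /wron -/c !(linearD (bc_act _)) /=.
  rewrite (cen_lbrl (lbr y c) _ crw) yc (cen_lbrl (lbr c h) _ crw).
  rewrite (lbrC c h) linearN /= hc oppr0 !lbr0l.
  by rewrite !add0r.
have h0 : (zeta * w * w) • h = 0.
  by rewrite sq crw (lbrC c h) linearN /= hc oppr0 lbr0r.
have cub : zeta * w * w * w = 0.
  by rewrite -[RHS](om0l y c) -h0 om_cenl //; apply: cenM.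
rewrite mulrC; apply: (@cen_nilp_eq0 _ 2) => //.
have -> : (zeta * w) ^+ 3 = zeta ^+ 2 * (zeta * w * w * w) by ring.
by rewrite cub mulr0.
Qed.

(** Evaluation at v + u and v - u gives the relations [X] and [Y]; by these the squares of b v u * l
    v and of Q u * l v vanish, which suffices for centroidal elements. *)
Lemma quad_lin_eq0 (Q l : L -> C) (b : L -> L -> C) :
  (forall u v, Q (u + v) = Q u + b u v + Q v) ->
  (forall u v, Q (u - v) = Q u - b u v + Q v) ->
  (forall u v, l (u + v) = l u + l v) -> (forall u v, l (u - v) = l u - l v) ->
  (forall u, J u -> centroidal (Q u)) ->
  (forall u v, J u -> J v -> centroidal (b u v)) ->
  (forall u, J u -> centroidal (l u)) ->
  (forall u, J u -> Q u * l u = 0) -> forall u v, J u -> J v -> Q u * l v = 0.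
Proof.
move=> QD QB lD lB cQ cb cl Ql u v Ju Jv.
have e1 := Ql _ (const_partD Jv Ju).
have e2 := Ql _ (const_partD Jv (const_partN Ju)).
rewrite QD lD in e1; rewrite QB lB in e2.
have e3 := Ql _ Ju; have e4 := Ql _ Jv.
have X : b v u * l u + Q u * l v = 0.
  apply: double_eq0.
  have -> : b v u * l u + Q u * l v + (b v u * l u + Q u * l v) =
    (Q v + b v u + Q u) * (l v + l u) + (Q v - b v u + Q u) * (l v - l u)
    - (Q v * l v + Q v * l v) by ring.
  by rewrite e1 e2 e4 !addr0 subrr.
have Y : Q v * l u + b v u * l v = 0.
  apply: double_eq0.
  have -> : Q v * l u + b v u * l v + (Q v * l u + b v u * l v) =
    (Q v + b v u + Q u) * (l v + l u) - (Q v - b v u + Q u) * (l v - l u)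
    - (Q u * l u + Q u * l u) by ring.
  by rewrite e1 e2 e3 !addr0 !subrr.
have bl : b v u * l v = 0.
  apply: cen_sqr_eq0; first by apply: cenM; [apply: cb | apply: cl].
  have -> : (b v u * l v) ^+ 2 = b v u * l v * (Q v * l u + b v u * l v)
     - b v u * l u * (Q v * l v) by ring.
  by rewrite Y e4 !mulr0 subrr.
apply: cen_sqr_eq0; first by apply: cenM; [apply: cQ | apply: cl].
have -> : (Q u * l v) ^+ 2 = Q u * l v * (b v u * l u + Q u * l v)
     - Q u * l u * (b v u * l v) by ring.
by rewrite X bl !mulr0 subrr.
Qed.

(** [pair_om_eq0] is polarized in its first argument, then in its second. *)
Lemma curv_om_eq0 a b h y : J a -> J b -> J h -> J y ->
  om a b (lbr a b) * om z h y = 0.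
Proof.
move=> Ja Jb Jh Jy.
have step1 u v y' : J u -> J v -> J y' -> om u y' (lbr u y') * om z v y' = 0.
  move=> Ju Jv Jy'.
  apply: (@quad_lin_eq0 (fun u => om u y' (lbr u y')) (fun v => om z v y')
    (fun u v => om u y' (lbr v y') + om v y' (lbr u y'))) => //.
  - by move=> p q; rewrite lbrDl !omDl !omDr; ring.
  - by move=> p q; rewrite lbrDl lbrNl !omDl !omDr !omNl !omNr; ring.
  - by move=> p q; rewrite omDm.
  - by move=> p q; rewrite omDm (om_cyc z (- q)) omNl -(om_cyc z).
  - by move=> p Jp; apply: om_cen.
  - move=> p q Jp Jq x t; rewrite !bc_actD lbrDr; congr (_ + _); exact: om_cen.
  - by move=> p Jp; apply: om_cen.
  - by move=> p Jp; apply: pair_om_eq0.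
apply: (@quad_lin_eq0 (fun u => om a u (lbr a u)) (fun v => om z h v)
    (fun u v => om a u (lbr a v) + om a v (lbr a u))) => //.
- by move=> p q; rewrite lbrDr !omDm !omDr; ring.
- move=> p q; rewrite lbrDr lbrNr !omDm !omDr !omNr (om_cyc a (- q)) (om_cyc a (- q)).
  by rewrite !omNl -!(om_cyc a); ring.
- by move=> p q; rewrite omDr.
- by move=> p q; rewrite omDr omNr.
- by move=> p Jp; apply: om_cen.
- move=> p q Jp Jq x t; rewrite !bc_actD lbrDr; congr (_ + _); exact: om_cen.
- by move=> p Jp; apply: om_cen.
- by move=> p Jp; apply: step1.
Qed.

(** The tensor [F] has the symmetries of a curvature tensor and zero sectional curvature, so it
    vanishes on J. By Cramer's rule rho om a b u then kills [J, J]; as om z h y takes values in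
    [J, J], it follows that rho^3 = 0. *)
Lemma om_z_eq0 h y : J h -> J y -> om z h y = 0.
Proof.
move=> Jh Jy; set rho := om z h y.
pose F a b c d := rho * om a b (lbr c d).
have FC a b c d : F a b c d = - F a b d c by rewrite /F lbrC omNr mulrN.
have FB a b c d : F a b c d = - F b a c d by rewrite /F om_swap mulrN.
have FDl a a' b c d : F (a + a') b c d = F a b c d + F a' b c d.
  by rewrite /F omDl mulrDr.
have FDr a b b' c d : F a (b + b') c d = F a b c d + F a b' c d.
  by rewrite /F omDm mulrDr.
have FD3 a b c c' d : F a b (c + c') d = F a b c d + F a b c' d.
  by rewrite /F lbrDl omDr mulrDr.
have FD4 a b c d d' : F a b c (d + d') = F a b c d + F a b c d'.
  by rewrite /F lbrDr omDr mulrDr.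
have F0 a b : J a -> J b -> F a b a b = 0.
  by move=> Ja Jb; rewrite /F mulrC; apply: curv_om_eq0.
have F1 a b c : J a -> J b -> J c -> F a b c b = 0.
  move=> Ja Jb Jc; apply: double_eq0.
  have := F0 _ _ (const_partD Ja Jc) Jb; rewrite FDl !FD3 !F0 // add0r addr0.
  rewrite {2}/F om_curv_sym //; om_cen_tac.
have F2 a b c d : J a -> J b -> J c -> J d -> F a b c d = - F a d c b.
  move=> Ja Jb Jc Jd; have := F1 _ _ _ Ja (const_partD Jb Jd) Jc.
  by rewrite FDr !FD4 !F1 // add0r addr0 => /eqP; rewrite addr_eq0 => /eqP ->.
have cyc4 a b c d : J a -> J b -> J c -> J d -> F b c d a = - F a b c d.
  move=> Ja Jb Jc Jd; rewrite (F2 a b c d) // (FB a d c b) (F2 d a c b) //.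
  by rewrite (FC d b c a) (FB d b a c) (F2 b d a c) // (FC b c a d) !opprK.
(* On J, [F] is now alternating in all four arguments, so the Bianchi identity reads 3 F = 0. *)
have F3 a b c d : J a -> J b -> J c -> J d -> F a b c d = 0.
  move=> Ja Jb Jc Jd; have /(om_bianchi d) : centroidal (om a b c) by apply: om_cen.
  rewrite !(om_cyc (lbr _ _)) => /(congr1 (fun r => rho * r)).
  rewrite mulr0 !mulrDr -/(F b c d a) -/(F c a d b) -/(F a b d c) (cyc4 a b c d) //.
  rewrite (cyc4 b c a d) // (FC b c a d) (cyc4 a b c d) // (FC a b d c) opprK => e.
  apply/eqP; suff : 3%:R *: F a b c d == 0 by rewrite scaler_eq0 natf_char0_eq0.
  by rewrite scaler_nat -oppr_eq0 -[X in _ == X]e; apply/eqP; ring.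
have kill a b u c d : J a -> J b -> J u -> J c -> J d ->
    (rho * om a b u) • lbr c d = 0.
  move=> Ja Jb Ju Jc Jd; rewrite bc_actM.
  have -> : om a b u • lbr c d = om a b (lbr c d) • u - om b (lbr c d) u • a
      - om (lbr c d) a u • b.
    by rewrite (om4 a b (lbr c d)); zmod.
  rewrite !linearB /= -!bc_actM -/(F a b c d) F3 //.
  rewrite (om_swapr b (lbr c d)) mulrN (om_cyc (lbr c d) a u).
  by rewrite -/(F b u c d) -/(F a u c d) !F3 // oppr0 !bc_act0 !subr0.
apply: (@cen_nilp_eq0 _ 2); first exact: om_cen.
apply: bc_ext => v; rewrite bc_act0 exprSr bc_actM {2}/rho omE /wron.
rewrite expr2 {2}/rho !(linearD (bc_act _)) /= !kill ?addr0 //.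
all: by [apply: const_partB | apply: const_part_lbrl].
Qed.

End Vanishing.

Lemma identity_eq0 (I : eqType) (f : free_lie k I) (l : I -> L) :
  (forall w : I -> W1tilde k, lie_subst w f = 0) -> lie_subst l f = 0.
Proof.
move=> f_identity; have Jz := identity_const_part l f_identity.
apply: om_radical_eq0 => // h y Jh Jy.
by apply: om_z_eq0 => // h' y' Jh' Jy'; apply: pair_B_eq0.
Qed.
End SL2Part.

Theorem corollary3 (k : fieldType) (char0 : [pchar k] =i pred0)
    (L : lieAlgType k) (Lsemiprime : lie_semiprime L)
    (LSt5 : standard_lie_identity5 L)
    (n : nat) (f : free_lie k 'I_n) :
  (forall w : 'I_n -> W1tilde k, lie_subst w f = 0) ->
  forall l : 'I_n -> L, lie_subst l f = 0.
Proof.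
(* A nonzero value of f provides the nonzero vector needed for 1 <> 0 in the ring [C]. *)
move=> f_identity l; apply: contrapT => /eqP f_neq0.
have L_neq0 : exists u : L, u != 0 by exists (lie_subst l f).
by move/eqP: f_neq0; apply; apply: (identity_eq0 char0 LSt5 Lsemiprime L_neq0).
Qed.
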